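(* For every cap body $K\subset\mathbb{R}^3$, the illumination number of $K$ satisfies $I(K)\le 6$.
   Context: Let $\mathbb{B}^3=\{x\in\mathbb{R}^3:\|x\|\le 1\}$ be the closed Euclidean unit ball centred at the origin, and let $\mathrm{conv}(\cdot)$ denote the closed convex hull. A set $K\subset\mathbb{R}^3$ is a cap body if $K=\mathrm{conv}(\mathbb{B}^3\cup\{x_1,\dots,x_m\})$ for some finite set of distinct points $x_1,\dots,x_m\in\mathbb{R}^3\setminus\mathbb{B}^3$ (the vertices) such that for all $1\le i<j\le m$ the closed segment joining $x_i$ and $x_j$ intersects $\mathbb{B}^3$. A convex body is a convex compact set with non-empty interior. A direction is a unit vector $v\in\mathbb{R}^3$. For a convex body $K$, a direction $v$ illuminates a point $x\in\partial K$ if the ray $\{x+tv: t\ge 0\}$ has nonempty intersection with the interior of $K$. A set of directions $\{v_1,\dots,v_k\}$ illuminates $K$ if every point of $\partial K$ is illuminated by some $v_i$. The illumination number $I(K)$ is the smallest $k$ for which $K$ can be illuminated by $k$ directions. *)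

(* Defs.v *)
From HB Require Import structures.
From mathcomp Require Import all_boot all_order all_algebra.
From mathcomp Require Import all_classical all_reals.
From mathcomp Require Import ereal topology normedtype convex.

Set Implicit Arguments.
Unset Strict Implicit.
Unset Printing Implicit Defensive.

Import Order.TTheory GRing.Theory Num.Theory.
Import numFieldNormedType.Exports.

Local Open Scope classical_set_scope.
Local Open Scope ring_scope.

(* R^n is 'rV[R]_n. The norm `|x| of the library on 'rV[R]_n is the sup norm:
   it is used here only through its topology, which is the usual one. *)
Definition euclid_norm (R : realType) (n : nat) (x : 'rV[R]_n) : R :=
  Num.sqrt (\sum_(i < n) x 0 i ^+ 2).

Definition euclid_unit_ball (R : realType) (n : nat) : set 'rV[R]_n :=
  [set x | euclid_norm x <= 1].

Definition segment (R : realType) (n : nat) (x y : 'rV[R]_n) : set 'rV[R]_n :=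
  [set (1 - t) *: x + t *: y | t in [set t : R | 0 <= t <= 1]].

Definition closed_convex_hull (R : realType) (n : nat) (A : set 'rV[R]_n) :
    set 'rV[R]_n :=
  smallest [set C : set 'rV[R]_n | closed C /\ convex_set C] A.

(* The vertices x_1, ..., x_m are distinct, and m = 0 is allowed, in which case
   K is the ball itself. *)
Definition cap_body (R : realType) (n : nat) (K : set 'rV[R]_n) : Prop :=
  exists (m : nat) (x : 'I_m -> 'rV[R]_n),
    [/\ injective x,
        forall i : 'I_m, ~ euclid_unit_ball (x i),
        forall i j : 'I_m, (i < j)%N ->
          segment (x i) (x j) `&` @euclid_unit_ball R n !=set0
      & K = closed_convex_hull (@euclid_unit_ball R n `|` range x)].

Definition boundary (T : topologicalType) (A : set T) : set T :=
  closure A `\` interior A.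

Definition direction (R : realType) (n : nat) (v : 'rV[R]_n) : Prop :=
  euclid_norm v = 1.

Definition ray (R : realType) (n : nat) (x v : 'rV[R]_n) : set 'rV[R]_n :=
  [set x + t *: v | t in [set t : R | 0 <= t]].

Definition illuminates_point (R : realType) (n : nat) (K : set 'rV[R]_n)
    (v x : 'rV[R]_n) : Prop :=
  ray x v `&` interior K !=set0.

Definition illuminated_by (R : realType) (n : nat) (K : set 'rV[R]_n)
    (k : nat) (v : 'I_k -> 'rV[R]_n) : Prop :=
  (forall i : 'I_k, direction (v i)) /\
  (forall x, boundary K x -> exists i : 'I_k, illuminates_point K (v i) x).

(* An infimum of natural numbers in the extended reals: it is the smallest such
   k when there is one, and +oo when no finite set of directions illuminates K.
   Allowing repetitions in the family v does not change it. *)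
Definition illumination_number (R : realType) (n : nat) (K : set 'rV[R]_n) :
    \bar R :=
  ereal_inf [set (k%:R)%:E | k in
    [set k : nat | exists v : 'I_k -> 'rV[R]_n, illuminated_by K v]].

(* Main.v *)
Require Import Defs.
From mathcomp Require Import all_boot all_order all_algebra.
From mathcomp Require Import all_classical all_reals.
From mathcomp Require Import ereal topology normedtype convex.
From mathcomp Require Import interval_inference ring lra.

(* Let t_i = sqrt (|x_i|^2 - 1) be the tangent of the angular radius of the cap seen from x_i.
   The cap condition makes the caps disjoint, and makes K the union of the spikes
   conv (B u {x_i}). If a unit vector W satisfies <W, x_i> > t_i, then x_i - <W, x_i> W is in the
   open ball, so -W illuminates the part of the spike of x_i that is off B. Hence we look for
   six vectors W that "hit" every x_i in this sense, and such that <W, b> > 0 for one of them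
   whenever b <> 0.

   Let e_3 point to the vertex of a largest cap. The six vectors are e_3, one further vector w,
   and a ring of four, at a fixed height below the equator, whose azimuth is free. If the largest
   cap is small, w = -e_3 and any azimuth do. Otherwise the ring misses only large caps. A cap
   missed at two azimuths of the list that we try is so large ("offending") that there is at most
   one such cap, and w points to it (w = -e_3 when there is none). So if all the azimuths failed,
   different azimuths would miss different caps. Large disjoint caps have vertices whose
   horizontal projections make pairwise angles larger than 60 degrees, or larger than 90 degrees
   when the largest cap is large enough: there is no room in the plane for six, respectively four,
   of them. *)

Set Implicit Arguments.
Unset Strict Implicit.
Unset Printing Implicit Defensive.

Import Order.TTheory GRing.Theory Num.Theory.
Import numFieldNormedType.Exports.

Local Open Scope classical_set_scope.
Local Open Scope ring_scope.

(** * Elementary inequalities: monotonicity, octagons, planar packing, convexity *)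

(** With T = tan theta the hypothesis reads h <= cos theta - t sin theta, whose right side decreases
    in theta. Disjointness from a polar cap thus passes to smaller polar caps, for instance to one
    with rational [k0]. *)
Lemma tangency_mono (R : realFieldType) (T0 k0 T k t h : R) :
  0 <= T0 -> T0 <= T -> 0 < k0 -> k0 ^+ 2 = 1 + T0 ^+ 2 ->
  0 < k -> k ^+ 2 = 1 + T ^+ 2 -> 0 <= t ->
  h * k <= 1 - t * T -> h * k0 <= 1 - t * T0.
Proof.
move=> T00 T0T k00 k0E k_0 kE t0 hk.
have k0k : k0 <= k by rewrite -(@ler_sqr _ k0 k) ?nnegrE ?(ltW k00) ?(ltW k_0) // k0E kE; nra.
have tT0T : t * T0 <= t * T by rewrite ler_wpM2l.
have [h0|h0] := leP 0 h; first by have : h * k0 <= h * k by [rewrite ler_wpM2l]; lra.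
have [tT|tT] := leP (t * T0) 1; first by have : h * k0 <= 0 by [rewrite nmulr_rle0 // ltW]; lra.
have T0p : 0 < T0 by rewrite lt_neqAle T00 andbT; apply/eqP =>
  T0E; move: tT; rewrite -T0E mulr0 ltr10.
have kT : k * T0 <= k0 * T.
  rewrite -(@ler_sqr _ (k * T0) (k0 * T)) ?nnegrE; [|nra|nra].
  have : T0 ^+ 2 <= T ^+ 2 by rewrite ler_sqr ?nnegrE //; lra.
  rewrite !exprMn k0E kE; lra.
have H1 : (t * T0 - 1) * T <= (t * T - 1) * T0 by nra.
have H2 : (t * T0 - 1) * k * T0 <= (t * T - 1) * k0 * T0.
  have : (t * T0 - 1) * (k * T0) <= (t * T0 - 1) * (k0 * T) by apply: ler_wpM2l => //; lra.
  have : ((t * T0 - 1) * T) * k0 <= ((t * T - 1) * T0) * k0 by apply: ler_wpM2r => //; lra.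
  lra.
rewrite (ler_pM2r T0p) in H2.
have : (h * k) * k0 <= (1 - t * T) * k0 by rewrite ler_wpM2r // ltW.
move=> H4; have H3 : h * k0 * k <= (1 - t * T0) * k by lra.
by rewrite (ler_pM2r k_0) in H3.
Qed.

(** Here [a] and [b] are the components of a planar vector along two unit vectors with inner product
    [g], and [N] is its squared length. The vector lies between the two, so the extreme case is a =
    b = m, where N = 2 m^2 / (1 + g). *)
Lemma cone_bound (R : realFieldType) (g mu m a b N : R) :
  0 < mu -> mu <= g -> g < 1 -> N * (1 - g ^+ 2) = a ^+ 2 + b ^+ 2 - 2 * g * a * b ->
  g * b <= a -> g * a <= b -> a <= m -> b <= m -> 0 <= N -> (1 + mu) * N <= 2 * m ^+ 2.
Proof.
move=> mu0 mug g1 NE gba gab am bm N0.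
have g0 : 0 <= g by lra.
have g2 : 0 < 1 - g ^+ 2 by rewrite expr2; nra.
have a0 : 0 <= a.
  by rewrite -(pmulr_rge0 _ g2); have : g * (g * a) <= g * b by [exact: ler_wpM2l]; lra.
have b0 : 0 <= b.
  by rewrite -(pmulr_rge0 _ g2); have : g * (g * b) <= g * a by [exact: ler_wpM2l]; lra.
have H : (N * (1 + g)) * (1 - g) <= (2 * m ^+ 2) * (1 - g).
  have -> : N * (1 + g) * (1 - g) = a * (a - g * b) + b * (b - g * a) by rewrite -[RHS]addr0; lra.
  have : a * (a - g * b) <= m * (a - g * b) by apply: ler_wpM2r => //; lra.
  have : b * (b - g * a) <= m * (b - g * a) by apply: ler_wpM2r => //; lra.
  have : (a + b) * (m * (1 - g)) <= (m + m) * (m * (1 - g)).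
    by apply: ler_wpM2r; [rewrite mulr_ge0//; lra|lra].
  lra.
rewrite ler_pM2r ?subr_gt0 // in H; nra.
Qed.

(* The bounds put (x, y) in the octagon cut out by two crosses; the farthest points of the sector
   between two adjacent normals are the vertices of the octagon. *)
Lemma octagon (R : realFieldType) (mu m C S x y : R) :
  0 < mu -> mu <= C -> mu <= S -> C ^+ 2 + S ^+ 2 = 1 ->
  `|x| <= m -> `|y| <= m -> `|C * x + S * y| <= m -> `|C * y - S * x| <= m ->
  (1 + mu) * (x ^+ 2 + y ^+ 2) <= 2 * m ^+ 2.
Proof.
move=> mu0 muC muS CS1.
wlog y0 : x y / 0 <= y => [hw|].
  have [|y0] := leP 0 y; first exact: hw.
  move=> h1 h2 h3 h4; rewrite -(sqrrN x) -(sqrrN y).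
  apply: hw; rewrite ?normrN //; first by lra.
    by rewrite !mulrN -opprD normrN.
  by rewrite !mulrN -opprD normrN.
rewrite !ler_norml => /andP[x1 x2] /andP[y1 y2] /andP[a1 a2] /andP[b1 b2].
have C1 : C < 1 by nra.
have S1 : S < 1 by nra.
have N0 : 0 <= x ^+ 2 + y ^+ 2 by rewrite addr_ge0 ?sqr_ge0.
have SE : S ^+ 2 = 1 - C ^+ 2 by lra.
have CE : C ^+ 2 = 1 - S ^+ 2 by lra.
(* The normals (1, 0), (C, S), (0, 1), (-S, C), (-1, 0) cut the upper half-plane into four sectors;
   neighbours have inner product C or S. *)
have [x0|x0] := leP 0 x.
  have [le|/ltW le] := leP (C * y) (S * x).
    apply: (@cone_bound _ C mu m x (C * x + S * y)) => //; last 2 first.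
    - by nra.
    - by nra.
    by ring: SE.
  apply: (@cone_bound _ S mu m y (C * x + S * y)) => //; [|nra|nra].
  by ring: CE.
have [le|/ltW le] := leP (- (C * x)) (S * y).
  apply: (@cone_bound _ C mu m y (C * y - S * x)) => //; [|nra|nra].
  by ring: SE.
apply: (@cone_bound _ S mu m (- x) (C * y - S * x)) => //; [|nra|nra|lra].
by ring: CE.
Qed.

(** The directions at least 60 degrees away from the positive first axis form four sectors of 60
    degrees. Both vectors are in the same sector, hence at most 60 degrees apart. *)
Lemma sector_dot (R : realFieldType) (a b a' b' : R) :
  0 <= b * b' -> (3 * a ^+ 2 <= b ^+ 2) = (3 * a' ^+ 2 <= b' ^+ 2) ->
  (a <= 0) || (3 * a ^+ 2 <= b ^+ 2) -> (a' <= 0) || (3 * a' ^+ 2 <= b' ^+ 2) ->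
  0 <= a * a' + b * b' /\
  (a ^+ 2 + b ^+ 2) * (a' ^+ 2 + b' ^+ 2) <= 4 * (a * a' + b * b') ^+ 2.
Proof.
move=> bb cE.
suff H : 0 <= (b ^+ 2 - 3 * a ^+ 2) * (b' ^+ 2 - 3 * a' ^+ 2) ->
   0 <= b * b' + 3 * (a * a') -> 0 <= a * a' + b * b' /\
   (a ^+ 2 + b ^+ 2) * (a' ^+ 2 + b' ^+ 2) <= 4 * (a * a' + b * b') ^+ 2.
  have [le|lt] := leP (3 * a ^+ 2) (b ^+ 2).
    have le' : 3 * a' ^+ 2 <= b' ^+ 2 by rewrite -cE.
    move=> _ _; apply: H; first by rewrite mulr_ge0 // subr_ge0.
    have : `|3 * (a * a')| <= `|b * b'|.
      rewrite -ler_sqr ?nnegrE // !real_normK ?num_real // !exprMn.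
      have : (3 * a ^+ 2) * (3 * a' ^+ 2) <= b ^+ 2 * b' ^+ 2.
        by apply: ler_pM => //; rewrite mulr_ge0 ?sqr_ge0.
      lra.
    by rewrite (ger0_norm bb) ler_norml; lra.
  have lt' : b' ^+ 2 < 3 * a' ^+ 2 by rewrite ltNge -cE -ltNge.
  rewrite orbF => a0; rewrite [X in _ || X]leNgt lt' orbF => a0'.
  have aa : 0 <= a * a' by rewrite mulr_le0.
  by apply: H; [rewrite mulr_le0 // subr_le0 ltW|lra].
move=> H1 H2.
(* Three times the difference of the two sides is the product in [H1] plus 8 (b b') (b b' + 3 a
   a'). *)
have H3 : 0 <= (b * b') * (b * b' + 3 * (a * a')) by rewrite mulr_ge0.
by split; nra.
Qed.

(* Relative to the first vector, the five others would be in four sectors of 60 degrees. *)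
Lemma six_planar (R : realFieldType) (x y q : 'I_6 -> R) :
  (forall i, 0 <= q i) -> (forall i, q i ^+ 2 = x i ^+ 2 + y i ^+ 2) ->
  (forall i j, i != j -> 2 * (x i * x j + y i * y j) < q i * q j) -> False.
Proof.
move=> q0 qE sep.
pose z : 'I_6 := ord0.
(* Coordinates along vector z and its quarter turn, scaled by the length of vector z. *)
pose a i := x z * x i + y z * y i; pose b i := x z * y i - y z * x i.
have qz : 0 < q z.
  rewrite lt_neqAle q0 andbT; apply/eqP => qz0.
  have := qE z; rewrite -qz0 expr0n /= => /eqP; rewrite eq_sym paddr_eq0 ?sqr_ge0 //.
  rewrite !sqrf_eq0 => /andP[/eqP xz /eqP yz].
  by have := sep z (lift ord0 ord0) isT; rewrite xz yz -qz0 !mul0r addr0 mulr0 ltxx.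
have abE i : a i ^+ 2 + b i ^+ 2 = q z ^+ 2 * q i ^+ 2 by rewrite /a /b !qE; ring.
have dotE i j : a i * a j + b i * b j = q z ^+ 2 * (x i * x j + y i * y j).
  by rewrite /a /b !qE; ring.
have far i : i != z -> (a i <= 0) || (3 * a i ^+ 2 <= b i ^+ 2).
  move=> iz; have [//|ai0/=] := leP (a i) 0.
  have h : 2 * a i < q z * q i by apply: sep; rewrite eq_sym.
  have : (2 * a i) ^+ 2 < (q z * q i) ^+ 2.
    by rewrite ltr_sqr ?nnegrE ?mulr_ge0 //; lra.
  by rewrite exprMn [X in _ < X]exprMn -abE; lra.
pose c (k : 'I_5) := (0 <= b (lift z k), 3 * a (lift z k) ^+ 2 <= b (lift z k) ^+ 2).
have /injectivePn[k [l kl ckl]] : ~~ injectiveb c.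
  apply/negP => /injectiveP /leq_card.
  by rewrite card_ord card_prod !card_bool.
set i := lift z k; set j := lift z l.
have ij : i != j by rewrite (inj_eq lift_inj).
have [c1 c2] : (0 <= b i) = (0 <= b j) /\ (3 * a i ^+ 2 <= b i ^+ 2) = (3 * a j ^+ 2 <= b j ^+ 2).
  by case: ckl.
have bb : 0 <= b i * b j.
  have [bi|bi] := leP 0 (b i); first by rewrite mulr_ge0 // -c1.
  by rewrite mulr_le0 // ltW // ltNge -c1 -ltNge.
have [] := sector_dot bb c2 (far i _) (far j _); rewrite ?neq_lift // 1?eq_sym ?neq_lift //.
move=> h1; apply/negP; rewrite -ltNge !abE.
have h : 2 * (a i * a j + b i * b j) < q z ^+ 2 * (q i * q j).
  by rewrite dotE mulrCA ltr_pM2l ?exprn_gt0 // sep.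
have : (2 * (a i * a j + b i * b j)) ^+ 2 < (q z ^+ 2 * (q i * q j)) ^+ 2.
  by rewrite ltr_sqr ?nnegrE ?mulr_ge0 ?sqr_ge0 //; lra.
by rewrite !exprMn; lra.
Qed.

(** The three other vectors lie in the open half-plane opposite to the first one. Two of them are on
    the same side of its axis, so their inner product is positive. *)
Lemma four_planar (R : realFieldType) (x y : 'I_4 -> R) :
  (forall i j, i != j -> x i * x j + y i * y j < 0) -> False.
Proof.
move=> sep.
pose z : 'I_4 := ord0.
pose a i := x z * x i + y z * y i; pose b i := x z * y i - y z * x i.
have dotE i j : a i * a j + b i * b j = (x z ^+ 2 + y z ^+ 2) * (x i * x j + y i * y j).
  by rewrite /a /b; ring.
pose c (k : 'I_3) := 0 <= b (lift z k).
have /injectivePn[k [l kl ckl]] : ~~ injectiveb c.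
  by apply/negP => /injectiveP /leq_card; rewrite card_ord card_bool.
set i := lift z k; set j := lift z l.
have ij : i != j by rewrite (inj_eq lift_inj).
have bb : 0 <= b i * b j.
  have cE : (0 <= b i) = (0 <= b j) by [].
  have [bi|bi] := leP 0 (b i); first by rewrite mulr_ge0 // -cE.
  by rewrite mulr_le0 // ltW // ltNge -cE -ltNge.
have ai : a i < 0 by apply: sep; rewrite neq_lift.
have aj : a j < 0 by apply: sep; rewrite neq_lift.
have := dotE i j; have : 0 < a i * a j by rewrite nmulr_rgt0.
have : (x z ^+ 2 + y z ^+ 2) * (x i * x j + y i * y j) <= 0.
  by rewrite mulr_ge0_le0 ?addr_ge0 ?sqr_ge0 // ltW // sep.
lra.
Qed.

(** A convex quadratic lies below its chord. In the estimates below, t is fixed and only the two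
    ends of the range of h are tested. *)
Lemma quad_lt (R : realFieldType) (A B M L U h : R) :
  0 <= A -> L <= h -> h <= U ->
  A * L ^+ 2 + B * L < M -> A * U ^+ 2 + B * U < M -> A * h ^+ 2 + B * h < M.
Proof.
move=> A0 Lh hU fL fU.
have [UL|UL] := leP U L; first by have -> : h = L by [lra].
have h1 : 0 <= A * (U - L) * ((h - L) * (U - h)).
  by rewrite !mulr_ge0 // subr_ge0 // ltW.
have h2 : 0 <= (U - h) * (M - (A * L ^+ 2 + B * L)) by rewrite mulr_ge0 ?subr_ge0 // ltW.
have h3 : 0 <= (h - L) * (M - (A * U ^+ 2 + B * U)) by rewrite mulr_ge0 ?subr_ge0 // ltW.
rewrite -subr_gt0 -(@pmulr_rgt0 _ (U - L)) ?subr_gt0 //.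
have -> : (U - L) * (M - (A * h ^+ 2 + B * h)) = (U - h) * (M - (A * L ^+ 2 + B * L)) +
  (h - L) * (M - (A * U ^+ 2 + B * U)) + A * (U - L) * ((h - L) * (U - h)) by ring.
have [hL|hL] := leP h L.
  have -> : h = L by lra.
  by rewrite subrr !mul0r mulr0 !addr0 mulr_gt0 ?subr_gt0.
have : 0 < (h - L) * (M - (A * U ^+ 2 + B * U)) by rewrite mulr_gt0 ?subr_gt0.
lra.
Qed.

(** * Disjointness from the polar cap; small polar caps *)

Section Tangency.
Variable R : rcfType.
Implicit Types t h T k : R.

(* Disjointness from a polar cap with vertex at distance sqrt (1 + T^2) from the origin: T and t
   are the tangents of the angular radii of the polar cap and of the other one, and h is the
   height of the vertex of the latter. *)
Definition tangent_to T t h := h * Num.sqrt (1 + T ^+ 2) <= 1 - t * T.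

Lemma sqrt1D_gt0 T : 0 < Num.sqrt (1 + T ^+ 2).
Proof. by rewrite sqrtr_gt0; have := sqr_ge0 T; lra. Qed.

Lemma sqrt1DK T : Num.sqrt (1 + T ^+ 2) ^+ 2 = 1 + T ^+ 2.
Proof. by rewrite sqr_sqrtr //; have := sqr_ge0 T; lra. Qed.

Lemma tangent_toW T0 T t h : 0 <= T0 -> T0 <= T -> 0 <= t ->
  tangent_to T t h -> tangent_to T0 t h.
Proof.
move=> T00 T0T t0; apply: tangency_mono => //; by rewrite ?sqrt1D_gt0 ?sqrt1DK.
Qed.

Lemma tangent_toE T0 k0 T t h : 0 <= T0 -> T0 <= T -> 0 <= t -> 0 < k0 ->
  k0 ^+ 2 = 1 + T0 ^+ 2 -> tangent_to T t h -> h * k0 <= 1 - t * T0.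
Proof.
by move=> T00 T0T t0 k00 k0E; apply: tangency_mono => //; rewrite ?sqrt1D_gt0 ?sqrt1DK.
Qed.

(* The conclusion is 2 (t + 3/16 h)^2 < (1 - (3/16)^2) (1 + t^2 - h^2). *)
Lemma small_caps T t h : T <= 17/20 -> 0 < t -> t <= T -> tangent_to T t h ->
  - t <= h -> h <= t -> 265 * (t ^+ 2 + h ^+ 2) + 192 * t * h < 247.
Proof.
move=> T1 t0 tT K th ht.
have t2 : t ^+ 2 <= 289/400 by nra.
have [h0|h0] := leP h 0.
  have : 0 <= (h + t) * (- h) by apply: mulr_ge0; lra.
  have : 0 <= (h + t) * t by apply: mulr_ge0; lra.
  lra.
(* Since t <= T, the polar cap may be shrunk to one of tangent t. *)
have {}K := tangent_toW (ltW t0) tT (ltW t0) K; rewrite /tangent_to in K.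
set k := Num.sqrt _ in K.
have k2 : k ^+ 2 = 1 + t ^+ 2 by rewrite sqrt1DK.
have k0 : 0 < k by rewrite sqrt1D_gt0.
set z := t ^+ 2 in t2 k2 *.
(* Up to t^2 = 1/3 the bound h <= t suffices; beyond it [K] bounds h. *)
have [z3|z3] := leP (3 * z) 1.
  have h1 : 0 <= (t - h) * t by apply: mulr_ge0; lra.
  have h2 : 0 <= (t - h) * h by apply: mulr_ge0; lra.
  have zE : t * t = z by rewrite /z expr2.
  have : h ^+ 2 <= z by lra.
  have : t * h <= z by lra.
  lra.
have zE : t * t = z by rewrite /z expr2.
have z0 : 0 <= 1 - z by lra.
have hk0 : 0 <= h * k by rewrite mulr_ge0 ?ltW.
have K' : h * k <= 1 - z by lra.
have H1 : h ^+ 2 * (1 + z) <= (1 - z) ^+ 2.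
  by rewrite -k2 -exprMn ler_sqr // nnegrE.
(* The square linearizes t k in z; 23/40 is near the middle of the range of t / k, about 0.5 to
   0.65. *)
have tk : 23/20 * (t * k) <= z + 529/1600 * (1 + z).
  have := sqr_ge0 (t - 23/40 * k); rewrite sqrrB exprMn k2 -/z; lra.
have tk0 : 0 <= t * k by rewrite mulr_ge0 ?ltW.
have H2 : (t * h) * (1 + z) <= (t * k) * (1 - z).
  rewrite -k2 expr2; have : (t * k) * (h * k) <= (t * k) * (1 - z) by rewrite ler_wpM2l.
  lra.
have H3 : 23/20 * (t * k) * (1 - z) <= (z + 529/1600 * (1 + z)) * (1 - z).
  by rewrite ler_wpM2r.
have H4 : 23/20 * ((t * h) * (1 + z)) <= (z + 529/1600 * (1 + z)) * (1 - z) by clear - H2 H3; lra.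
have z1 : 0 < 1 + z by clear - z3; lra.
have H5 : 0 <= (z - 1/3) * (289/400 - z) by apply: mulr_ge0; clear - z3 t2; lra.
rewrite -/z -subr_gt0 -(pmulr_rgt0 _ z1).
clear - H1 H4 H5 z3 t2; lra.
Qed.

End Tangency.

(** * Medium caps: the offending ones *)

Section Mid.
Variable R : rcfType.
Implicit Types t h T k : R.

(* The tangents T_0 = 88/105, 20/21, 55/48, 45/28 are those for which sqrt (1 + T_0^2) is a
   simple rational. *)
Lemma tangent_line_88_105 T t h : 17/20 <= T -> 0 < t -> tangent_to T t h ->
  137 * h <= 105 - 88 * t.
Proof.
move=> T1 t0 /(@tangent_toE _ (88/105) (137/105)) K.
by have := K ltac:(lra) ltac:(lra) ltac:(lra) ltac:(lra) ltac:(lra); lra.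
Qed.

Lemma tangent_line_20_21 T t h : 1 <= T -> 0 < t -> tangent_to T t h -> 29 * h <= 21 - 20 * t.
Proof.
move=> T1 t0 /(@tangent_toE _ (20/21) (29/21)) K.
by have := K ltac:(lra) ltac:(lra) ltac:(lra) ltac:(lra) ltac:(lra); lra.
Qed.

Lemma tangent_line_55_48 T t h : 55/48 <= T -> 0 < t -> tangent_to T t h -> 73 * h <= 48 - 55 * t.
Proof.
move=> T1 t0 /(@tangent_toE _ (55/48) (73/48)) K.
by have := K ltac:(lra) ltac:(lra) ltac:(lra) ltac:(lra) ltac:(lra); lra.
Qed.

Lemma tangent_line_45_28 T t h : 45/28 <= T -> 0 < t -> tangent_to T t h -> 53 * h <= 28 - 45 * t.
Proof.
move=> T1 t0 /(@tangent_toE _ (45/28) (53/28)) K.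
by have := K ltac:(lra) ltac:(lra) ltac:(lra) ltac:(lra) ltac:(lra); lra.
Qed.

(* Below, 4 <= 5 t^2 + 6 t h + 5 h^2 stands for 4 (1 + t^2 - h^2) <= (3 t + h)^2; likewise
   5 <= 4 t^2 + 6 t h + 6 h^2 and 6 <= 3 t^2 + 6 t h + 7 h^2 with factors 5 and 6. Here
   1 + t^2 - h^2 is the squared distance of the vertex to the axis. *)
Lemma mid_offending T t h : 17/20 <= T -> 0 < t -> t <= T -> t <= 13/10 -> tangent_to T t h ->
  - t <= h -> h <= t -> 5 <= 4 * t ^+ 2 + 6 * t * h + 6 * h ^+ 2 -> h <= -1.
Proof.
move=> T1 t0 tT t1 K th ht; apply: contraTT; rewrite -!ltNge => h1.
suff : 6 * h ^+ 2 + (6 * t) * h < 5 - 4 * t ^+ 2 by lra.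
have [t_1|t_1] := leP t 1.
  have lK := tangent_line_88_105 T1 t0 K.
  have tt : t ^+ 2 <= 1 by rewrite expr_le1 // ltW.
  have [t2|t2] := leP t (7/15).
    apply: (@quad_lt _ _ _ _ (-t) t) => //; first by rewrite sqrrN; lra.
    have : t * t <= (7/15) * t by rewrite ler_wpM2r // ltW.
    lra.
  apply: (@quad_lt _ _ _ _ (-t) ((105 - 88 * t) / 137)); [lra|lra|lra|rewrite sqrrN; lra|].
  have : 0 <= (t - 7/15) * (1 - t) by apply: mulr_ge0; lra.
  lra.
(* For t > 1 the lower end of the range of h is the assumed -1. Beyond t = 55/48 a steeper tangent
   line is available because T >= t. *)
have tb : 0 <= (t - 1) * (13/10 - t) by apply: mulr_ge0; lra.
have [t2|t2] := leP t (55/48).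
  have lK : 29 * h <= 21 - 20 * t by apply: tangent_line_20_21 K; lra.
  apply: (@quad_lt _ _ _ _ (-1) ((21 - 20 * t) / 29)); [lra|lra|lra|lra|].
  have : 0 <= (t - 1) * (55/48 - t) by apply: mulr_ge0; lra.
  lra.
have lK : 73 * h <= 48 - 55 * t by apply: tangent_line_55_48 K; lra.
apply: (@quad_lt _ _ _ _ (-1) ((48 - 55 * t) / 73)); [lra|lra|lra|lra|].
have : 0 <= (t - 55/48) * (13/10 - t) by apply: mulr_ge0; lra.
lra.
Qed.

(** Disjoint offending caps satisfy the reverse inequality by [separated], so there is at most
    one. *)
Lemma mid_offending_pair t h t' h' : h <= -1 -> h' <= -1 -> - t <= h -> - t' <= h' ->
  t <= 13/10 -> t' <= 13/10 ->
  (3 * t + h) * (3 * t' + h') < 5 * (t * t' + h * h' - 1).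
Proof.
move=> h1 h1' th th' t1 t1'.
have a1 : 0 <= (t) * (- 1 - h') by apply: mulr_ge0; lra.
have a2 : 0 <= (t') * (- 1 - h) by apply: mulr_ge0; lra.
have a3 : 0 <= (-1 - h) * (- h') by apply: mulr_ge0; lra.
have a4 : 0 <= (13/10 - t) * (4 * t' - 3) by apply: mulr_ge0; lra.
lra.
Qed.

(** With s = - h, the form 5 t^2 - 6 t s + 5 s^2 is convex. The region t <= s <= u0 + u1 t is a
    triangle with corners (0, 0), (0, u0), (ts, ts), where the form is 0, 5 u0^2 and 4 ts^2, all
    below 4. *)
Lemma ring_far u0 u1 t h : 0 <= u1 -> 0 < u0 -> u0 + u1 < 1 -> 5 * u0 ^+ 2 < 4 ->
  0 <= t -> h <= - t -> 4 <= 5 * t ^+ 2 + 6 * t * h + 5 * h ^+ 2 -> u0 + u1 * t < - h.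
Proof.
move=> u10 u00 u01 u02 t0 ht; apply: contraTT; rewrite -leNgt -ltNge => hU.
pose ts := u0 / (1 - u1).
have u1_1 : 0 < 1 - u1 by lra.
have tsE : ts * (1 - u1) = u0 by rewrite divfK // gt_eqF.
have ts1 : ts < 1 by rewrite ltr_pdivrMr //; lra.
have ts0 : 0 < ts by rewrite divr_gt0.
have ts2 : ts ^+ 2 < 1 by rewrite expr_lt1 // ltW.
have tts : t <= ts by rewrite ler_pdivlMr //; lra.
have t2 : t ^+ 2 <= ts ^+ 2 by rewrite ler_sqr // nnegrE ltW.
have t2t : t * t = t ^+ 2 by rewrite expr2.
have Q : (5 - 6 * u1 + 5 * u1 ^+ 2) * t ^+ 2 + (10 * u0 * u1 - 6 * u0) * t < 4 - 5 * u0 ^+ 2.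
  apply: (@quad_lt _ _ _ _ 0 ts) => //.
  - by have := sqr_ge0 (u1 - 3/5); lra.
  - by rewrite expr0n /= !mulr0 addr0; lra.
  have e1 : ts = u0 + u1 * ts by rewrite -tsE; ring.
  have e2 : ts ^+ 2 = (u0 + u1 * ts) ^+ 2 by rewrite -e1.
  have e3 : ts ^+ 2 = ts * (u0 + u1 * ts) by rewrite -e1 expr2.
  lra.
suff : 5 * (- h) ^+ 2 + - (6 * t) * - h < 4 - 5 * t ^+ 2 by rewrite sqrrN; lra.
by apply: (@quad_lt _ _ _ _ t (u0 + u1 * t)); lra.
Qed.

(** Here [a] and [b] are the tangent and the depth of an offending cap, and the other cap has its
    vertex at depth at least t. As 76/17 is just below sqrt (5 * 4), [separated] excludes such a
    disjoint pair. *)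
Lemma mid_offending_low a b t h : 1 <= b -> b <= a -> a <= 13/10 -> 0 <= t -> h <= - t ->
  4 <= 5 * t ^+ 2 + 6 * t * h + 5 * h ^+ 2 ->
  (3 * a - b) * (3 * t + h) < 76/17 * (a * t - b * h - 1).
Proof.
move=> b1 ba a1 t0 ht F.
(* At b = 1 the claim is affine in a: [g1] settles the end a = 13/10 and [g2] the end a = 1. *)
have g1 : 17/28 + 20/51 * t < - h by apply: ring_far => //; lra.
have g2 : 7/10 + 1/4 * t < - h by apply: ring_far => //; lra.
have {F} a1' : 1 <= a by lra.
have a2 : 0 <= (b - 1) * (3 * t - 59/17 * h) by apply: mulr_ge0; lra.
have a3 : 0 <= (a - 1) * (- h - (17/28 + 20/51 * t)) by apply: mulr_ge0; lra.
have a4 : 0 <= (13/10 - a) * (- h - (7/10 + 1/4 * t)) by apply: mulr_ge0; lra.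
have a5 : 0 <= (a - 1) * t by apply: mulr_ge0; lra.
have a6 : 0 <= (13/10 - a) * t by apply: mulr_ge0; lra.
lra.
Qed.

End Mid.

(** * Medium caps: pairs missed by the ring *)

Section Mid.
Variable R : rcfType.
Implicit Types t h T k q : R.

(** A cap above the equator must be this large to be missed by the ring. The split points 7/15 here
    and 3/7 in the next lemma are where the tangent line meets h = t. *)
Lemma ring_bad_nneg T t h : 17/20 <= T -> 0 < t -> tangent_to T t h -> h <= t -> 0 <= h ->
  4 <= 5 * t ^+ 2 + 6 * t * h + 5 * h ^+ 2 -> 5/8 <= t.
Proof.
move=> T1 t0 K ht h0; apply: contraTT; rewrite -!ltNge => t1.
have lK := tangent_line_88_105 T1 t0 K.
suff : 5 * h ^+ 2 + (6 * t) * h < 4 - 5 * t ^+ 2 by lra.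
have [t2|t2] := leP t (7/15).
  have : t * t <= (7/15) * (7/15) by apply: ler_pM; first [by clear; lra|exact: ltW|lra].
  by move=> tt; apply: (@quad_lt _ _ _ _ 0 t) => //; lra.
have : 0 <= (t - 7/15) * (5/8 - t) by apply: mulr_ge0; lra.
by move=> tt; apply: (@quad_lt _ _ _ _ 0 ((105 - 88 * t) / 137)); lra.
Qed.

Lemma ring_bad_nneg_ge1 T t h : 1 <= T -> 0 < t -> tangent_to T t h -> h <= t -> 0 <= h ->
  4 <= 5 * t ^+ 2 + 6 * t * h + 5 * h ^+ 2 -> 3/4 <= t.
Proof.
move=> T1 t0 K ht h0; apply: contraTT; rewrite -!ltNge => t1.
have lK := tangent_line_20_21 T1 t0 K.
suff : 5 * h ^+ 2 + (6 * t) * h < 4 - 5 * t ^+ 2 by lra.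
have [t2|t2] := leP t (3/7).
  have : t * t <= (3/7) * (3/7) by apply: ler_pM; first [by clear; lra|exact: ltW|lra].
  by move=> tt; apply: (@quad_lt _ _ _ _ 0 t) => //; lra.
have : 0 <= (t - 3/7) * (3/4 - t) by apply: mulr_ge0; lra.
by move=> tt; apply: (@quad_lt _ _ _ _ 0 ((21 - 20 * t) / 29)); lra.
Qed.

(** For - t <= h < 0 the terms in h add up to a negative number, whence the bound on t. If t < 1,
    the form is below 4 at h = - t and at h = -1/5, hence between them. *)
Lemma ring_bad_neg t h : 0 < t -> - t <= h -> h < 0 ->
  4 <= 5 * t ^+ 2 + 6 * t * h + 5 * h ^+ 2 -> 4/5 <= t ^+ 2 /\ (t < 1 -> - (1/5) <= h).
Proof.
move=> t0 th h0 F; split.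
  have : 0 <= - h * (h + t) by apply: mulr_ge0; lra.
  have : 0 <= - h * t by apply: mulr_ge0; lra.
  lra.
move=> t1; apply: contraTT F; rewrite -!ltNge => h1.
have t2 : t ^+ 2 < 1 by rewrite expr_lt1 // ltW.
suff : 5 * h ^+ 2 + (6 * t) * h < 4 - 5 * t ^+ 2 by lra.
have : 0 < (t - 1/5) * (1 - t) by apply: mulr_gt0; lra.
by move=> tt; apply: (@quad_lt _ _ _ _ (-t) (-(1/5))); lra.
Qed.

Lemma root_lb t h q c : 0 <= q -> q ^+ 2 = 1 + t ^+ 2 - h ^+ 2 -> 0 <= c ->
  c ^+ 2 <= 1 + t ^+ 2 - h ^+ 2 -> c <= q.
Proof. by move=> q0 qE c0; rewrite -qE ler_sqr. Qed.

(** Together with disjointness this bounds the inner product of the horizontal projections, of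
    lengths q and q', strictly below q q' / 2: they are more than 60 degrees apart. *)
Lemma mid_bad_pair T t h q t' h' q' : 17/20 <= T ->
  0 < t -> t <= T -> t <= 13/10 -> tangent_to T t h -> - t <= h -> h <= t ->
  0 <= q -> q ^+ 2 = 1 + t ^+ 2 - h ^+ 2 -> 4 <= 5 * t ^+ 2 + 6 * t * h + 5 * h ^+ 2 ->
  0 < t' -> t' <= T -> t' <= 13/10 -> tangent_to T t' h' -> - t' <= h' -> h' <= t' ->
  0 <= q' -> q' ^+ 2 = 1 + t' ^+ 2 - h' ^+ 2 ->
  4 <= 5 * t' ^+ 2 + 6 * t' * h' + 5 * h' ^+ 2 ->
  1 < t * t' + h * h' + q * q' / 2.
Proof.
move=> T1; wlog : t h q t' h' q' / h <= h'.
  move=> hw; have [hh|/ltW hh] := leP h h' => *; first exact: hw.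
  have := hw _ _ _ _ _ _ hh; rewrite (mulrC t) (mulrC h) (mulrC q); exact.
move=> hh t0 tT t13 K th ht q0 qE F t0' tT' t13' K' th' ht' q0' qE' F'.
have up (s g r : R) : 0 <= g -> 5/8 <= s -> tangent_to T s g -> 0 <= r ->
  r ^+ 2 = 1 + s ^+ 2 - g ^+ 2 ->
    g <= 3/8 /\ 10/9 <= r.
  move=> g0 s1 Ks r0 rE; have lK := tangent_line_88_105 T1 (lt_le_trans _ s1) Ks.
  have {lK} g1 : 137 * g <= 50 by have := lK ltac:(lra); lra.
  split; first by lra.
  apply: (root_lb r0 rE); first by lra.
  have : (5/8) * (5/8) <= s * s by apply: ler_pM; first [by clear; lra|assumption|lra].
  have : g * g <= (3/8) * (3/8) by apply: ler_pM; first [by clear; lra|assumption|lra].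
  lra.
have dn (s g r : R) : 0 < s -> - s <= g -> g < 0 -> 0 <= r ->
  r ^+ 2 = 1 + s ^+ 2 - g ^+ 2 -> 1 <= r.
  move=> s0 sg g0 r0 rE; apply: (root_lb r0 rE); first by lra.
  have : 0 <= (s + g) * (s - g) by apply: mulr_ge0; lra.
  lra.
have [h0|h0] := leP 0 h.
  have h0' : 0 <= h' by lra.
  have t1 := ring_bad_nneg T1 t0 K ht h0 F.
  have t1' := ring_bad_nneg T1 t0' K' ht' h0' F'.
  have [_ q1] := up _ _ _ h0 t1 K q0 qE.
  have [_ q1'] := up _ _ _ h0' t1' K' q0' qE'.
  have : (5/8) * (5/8) <= t * t' by apply: ler_pM; first [by clear; lra|assumption|lra].
  have : (10/9) * (10/9) <= q * q' by apply: ler_pM; first [by clear; lra|assumption|lra].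
  have : 0 <= h * h' by apply: mulr_ge0.
  clear; lra.
have [t2 hlo] := ring_bad_neg t0 th h0 F.
have t89 : 8/9 <= t by rewrite -ler_sqr ?nnegrE; clear - t2 t0; lra.
have q1 := dn _ _ _ t0 th h0 q0 qE.
have [h0'|h0'] := ltP h' 0.
  have [t2' _] := ring_bad_neg t0' th' h0' F'.
  have t89' : 8/9 <= t' by rewrite -ler_sqr ?nnegrE; clear - t2' t0'; lra.
  have q1' := dn _ _ _ t0' th' h0' q0' qE'.
  have : (8/9) * (8/9) <= t * t' by apply: ler_pM; first [by clear; lra|assumption|lra].
  have : 1 * 1 <= q * q' by apply: ler_pM; first [by clear; lra|assumption|lra].
  have : 0 <= h * h' by rewrite mulr_le0 // ltW.
  clear; lra.
(* On opposite sides of the equator h h' is not positive. If t < 1, it is small because h >= -1/5;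
   otherwise T >= 1 and the sharper tangent line makes t' and q' larger. *)
have [t1|t1] := ltP t 1.
  have {}hlo := hlo t1.
  have t1' := ring_bad_nneg T1 t0' K' ht' h0' F'.
  have [h1' q1'] := up _ _ _ h0' t1' K' q0' qE'.
  have {}q1 : 13/10 <= q.
    apply: (root_lb q0 qE); first by lra.
    have : 0 <= (1/5 + h) * (1/5 - h) by apply: mulr_ge0; lra.
    lra.
  have : (8/9) * (5/8) <= t * t' by apply: ler_pM; first [by clear; lra|assumption|lra].
  have : (13/10) * (10/9) <= q * q' by apply: ler_pM; first [by clear; lra|assumption|lra].
  have : 0 <= (h + 1/5) * h' by apply: mulr_ge0; lra.
  clear - h1'; lra.
have T_1 : 1 <= T by lra.
have t1' := ring_bad_nneg_ge1 T_1 t0' K' ht' h0' F'.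
have h1' : h' <= 6/29 by have := tangent_line_20_21 T_1 t0' K'; lra.
have q1' : 6/5 <= q'.
  apply: (root_lb q0' qE'); first by lra.
  have : (3/4) * (3/4) <= t' * t' by apply: ler_pM; first [by clear; lra|assumption|lra].
  have : h' * h' <= (6/29) * (6/29) by apply: ler_pM; first [by clear; lra|assumption|lra].
  clear; lra.
have : 1 * (3/4) <= t * t' by apply: ler_pM; first [by clear; lra|assumption|lra].
have : 1 * (6/5) <= q * q' by apply: ler_pM; first [by clear; lra|assumption|lra].
have : 0 <= (h + 13/10) * h' by apply: mulr_ge0; lra.
clear - h1'; lra.
Qed.

End Mid.

(** * Large polar caps *)

Section Big.
Variable R : rcfType.
Implicit Types t h T k q : R.

(** The irrational sqrt (1 + (13/10)^2) = 1.6401... is enclosed between 1.64 and 1.641; the sign of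
    h decides which end is usable. *)
Lemma tangent_line_13_10 T t h : 13/10 <= T -> 0 < t -> tangent_to T t h ->
  (0 <= h -> 41 * h <= 25 * (1 - 13/10 * t)) /\
  (h <= 0 -> 10 * (13/10 * t - 1) <= - (h * (16 + 41/100))).
Proof.
move=> T1 t0 K.
have := tangent_toW (_ : 0 <= 13/10) T1 (ltW t0) K; rewrite /tangent_to.
set k := Num.sqrt _ => /(_ ltac:(lra)) {}K.
have k2 : k ^+ 2 = 1 + (13/10) ^+ 2 by rewrite sqrt1DK.
have k0 : 0 < k by rewrite sqrt1D_gt0.
have k1 : 41/25 <= k by rewrite -ler_sqr ?nnegrE; lra.
have k3 : k <= (16 + 41/100) / 10 by rewrite -ler_sqr ?nnegrE; lra.
split=> h0.
  have : 0 <= h * (k - 41/25) by apply: mulr_ge0; lra.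
  lra.
have : 0 <= - h * ((16 + 41/100) / 10 - k) by apply: mulr_ge0; lra.
lra.
Qed.

(** The bounds are made so that (493/500)^2 + (17/100)^2 > 1: the horizontal projections of two such
    disjoint caps then make an obtuse angle. *)
Lemma big_bad T t h : 13/10 <= T -> 0 < t -> tangent_to T t h -> - t <= h -> h <= t ->
  4 <= 5 * t ^+ 2 + 6 * t * h + 5 * h ^+ 2 -> 493/500 <= t /\ h <= - (17/100).
Proof.
move=> T1 t0 K th ht F.
have [lp ln] := tangent_line_13_10 T1 t0 K.
suff t1 : 493/500 <= t.
  split=> //; have [h0|h0] := leP 0 h; first by have := lp h0; lra.
  by have := ln (ltW h0); lra.
apply: contraTT F; rewrite -!ltNge => t1.
have t2 : t * t <= (493/500) * (493/500) by apply: ler_pM; first [by clear; lra|exact: ltW|lra].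
suff : 5 * h ^+ 2 + (6 * t) * h < 4 - 5 * t ^+ 2 by lra.
have lo : 5 * (- t) ^+ 2 + 6 * t * (- t) < 4 - 5 * t ^+ 2 by lra.
have [h0|h0] := leP 0 h.
  have {}lp := lp h0.
  have [t3|t3] := leP t (1/3).
    have : t * t <= (1/3) * (1/3) by apply: ler_pM; first [by clear; lra|exact: ltW|lra].
    by move=> tt; apply: (@quad_lt _ _ _ _ (- t) t) => //; lra.
  have : 0 <= (t - 1/3) * (10/13 - t) by apply: mulr_ge0; lra.
  by move=> tt; apply: (@quad_lt _ _ _ _ (- t) (25/41 * (1 - 13/10 * t))) => //; lra.
have {lp}ln := ln (ltW h0).
(* The tangent line crosses h = 0 at t = 10/13; beyond it, the line gives the negative upper bound
   [U] for h. *)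
have [t3|t3] := leP t (10/13).
  have : t * t <= (10/13) * (10/13) by apply: ler_pM; first [by clear; lra|exact: ltW|lra].
  by move=> tt; apply: (@quad_lt _ _ _ _ (- t) 0) => //; lra.
have tt : 0 <= (t - 10/13) * (493/500 - t) by apply: mulr_ge0; lra.
set c : R := 16 + 41/100 in ln *.
have c0 : 0 < c by rewrite /c; lra.
pose U := (10 * (1 - 13/10 * t)) / c.
have UE : U * c = 10 - 13 * t by rewrite /U divfK ?gt_eqF //; lra.
have hU : h <= U by rewrite ler_pdivlMr //; lra.
apply: (@quad_lt _ _ _ _ (- t) U) => //.
rewrite -(@ltr_pM2r _ (c ^+ 2)) ?exprn_gt0 //.
have -> : (5 * U ^+ 2 + 6 * t * U) * c ^+ 2 = 5 * (U * c) ^+ 2 + 6 * t * (U * c) * c by ring.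
by rewrite UE /c; clear - tt t1 t3; lra.
Qed.

Lemma big_offending T t h : 13/10 <= T -> 0 < t -> t <= T -> tangent_to T t h -> - t <= h ->
  h <= t ->
  4 <= 5 * t ^+ 2 + 6 * t * h + 5 * h ^+ 2 -> 6 <= 3 * t ^+ 2 + 6 * t * h + 7 * h ^+ 2 ->
  h <= -1 /\ t <= - (9/5 * h).
Proof.
move=> T1 t0 tT K th ht F G.
have [t1 h1] := big_bad T1 t0 K th ht F.
have h0 : h <= 0 by lra.
have ln := (tangent_line_13_10 T1 t0 K).2 h0.
have [t2|t2] := leP (9/5) t.
  have lK : 53 * h <= 28 - 45 * t by apply: tangent_line_45_28 K; lra.
  lra.
have tt : 0 <= (t - 493/500) * (9/5 - t) by apply: mulr_ge0; lra.
have {F} hi : 7 * (25/42 * (1 - 13/10 * t)) ^+ 2 + 6 * t * (25/42 * (1 - 13/10 * t))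
  < 6 - 3 * t ^+ 2.
  by lra.
have hU : h <= 25/42 * (1 - 13/10 * t) by lra.
suff H : h <= -1 by lra.
apply: contraTT G; rewrite -!ltNge => G.
suff : 7 * h ^+ 2 + (6 * t) * h < 6 - 3 * t ^+ 2 by lra.
apply: (@quad_lt _ _ _ _ (-1) (25/42 * (1 - 13/10 * t))) => //; lra.
Qed.

Lemma big_offending_pair t h t' h' : h <= -1 -> h' <= -1 -> - t <= h -> - t' <= h' ->
  t <= - (9/5 * h) -> t' <= - (9/5 * h') ->
  (3 * t + h) * (3 * t' + h') < 6 * (t * t' + h * h' - 1).
Proof.
move=> h1 h1' th th' t1 t1'.
have : (t + h) * (t' + h') <= (- (4/5 * h)) * (- (4/5 * h'))
  by apply: ler_pM; first [by clear; lra|exact: ltW|lra].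
have : 1 * 1 <= (- h) * (- h') by apply: ler_pM; first [by clear; lra|exact: ltW|lra].
lra.
Qed.

(** As for medium caps, now with 93/19 just below sqrt (6 * 4). *)
Lemma big_offending_low a b t h : 1 <= b -> b <= a -> a <= 9/5 * b -> 0 <= t -> h <= - t ->
  4 <= 5 * t ^+ 2 + 6 * t * h + 5 * h ^+ 2 ->
  (3 * a - b) * (3 * t + h) < 93/19 * (a * t - b * h - 1).
Proof.
move=> b1 ba a1 t0 ht F.
have g1 : 39/74 + 26/55 * t < - h by apply: ring_far => //; lra.
have g2 : 3/4 + 1/5 * t < - h by apply: ring_far => //; lra.
clear F.
(* Apart from the constant, the claim is linear in (a, b). It is tested on the extreme rays (9/5, 1)
   and (1, 1) of the cone b <= a <= 9/5 b; the margin 1/300 gives strictness. *)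
have p1 : 93/19 + 1/300 <= - (9/5 * ((9 - 93/19) * t + 3 * h) - (3 * t - (93/19 - 1) * h)).
  by clear - g1 t0; lra.
have p2 : 93/19 + 1/300 <= - ((9 - 93/19) * t + 3 * h - (3 * t - (93/19 - 1) * h)).
  by clear - g2 t0; lra.
have {p1}a1' : 0 <= (a - b) *
    (- (9/5 * ((9 - 93/19) * t + 3 * h) - (3 * t - (93/19 - 1) * h)) - (93/19 + 1/300)).
  by apply: mulr_ge0; clear - ba p1; lra.
have {p2}a2 : 0 <= (9/5 * b - a) *
    (- ((9 - 93/19) * t + 3 * h - (3 * t - (93/19 - 1) * h)) - (93/19 + 1/300)).
  by apply: mulr_ge0; clear - a1 p2; lra.
clear - b1 a1' a2; lra.
Qed.

End Big.

(** * Systems of disjoint caps and vectors that hit them *)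

(* The cap i has the vertex (px i, py i, ph i), and pt i is the tangent of its angular radius. *)
Structure caps (R : rcfType) (I : finType) := Caps {
  px : I -> R; py : I -> R; ph : I -> R; pt : I -> R; top : I;
  pt_gt0 : forall i, 0 < pt i;
  vertexE : forall i, px i ^+ 2 + py i ^+ 2 + ph i ^+ 2 = 1 + pt i ^+ 2;
  disjoint_caps : forall i j, i != j ->
    px i * px j + py i * py j + ph i * ph j <= 1 - pt i * pt j;
  px_top : px top = 0;
  py_top : py top = 0;
  ph_top : 0 < ph top;
  pt_max : forall i, pt i <= pt top
}.

(* The cap i is missed by the four vectors (u, -b) with u = a (c, s) up to quarter turns. *)
Definition missed (R : rcfType) (I : finType) (K : caps R I) (a b c s : R) (i : I) :=
  (a * `|c * px K i + s * py K i| <= pt K i + b * ph K i) &&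
  (a * `|c * py K i - s * px K i| <= pt K i + b * ph K i).

Definition pole_hit (R : rcfType) (I : finType) (K : caps R I) (w : R * R * R) (i : I) :=
  (pt K i < ph K i) || (pt K i < w.1.1 * px K i + w.1.2 * py K i + w.2 * ph K i).

Lemma rotated_missedE (R : rcfType) (I : finType) (K : caps R I) (c s c' s' : R) i :
  c ^+ 2 + s ^+ 2 = 1 ->
  let C := c * c' + s * s' in let S := c * s' - s * c' in
  let X := c * px K i + s * py K i in let Y := c * py K i - s * px K i in
  c' * px K i + s' * py K i = C * X + S * Y /\ c' * py K i - s' * px K i = C * Y - S * X.
Proof.
move=> cs /=; split.
  rewrite -[LHS]mul1r -cs; ring.
rewrite -[LHS]mul1r -cs; ring.
Qed.

(** Squaring and adding the two bounds eliminates the azimuth. *)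
Lemma missed_sum (R : rcfType) (I : finType) (K : caps R I) (a b c s : R) i : 0 < a ->
  c ^+ 2 + s ^+ 2 = 1 -> missed K a b c s i ->
  0 <= pt K i + b * ph K i /\
  a ^+ 2 * (px K i ^+ 2 + py K i ^+ 2) <= 2 * (pt K i + b * ph K i) ^+ 2.
Proof.
move=> a0 cs /andP[m1 m2].
have p0 : 0 <= pt K i + b * ph K i by apply: le_trans m1; rewrite mulr_ge0 // ltW.
split=> //.
have sq u : a * `|u| <= pt K i + b * ph K i -> a ^+ 2 * u ^+ 2 <= (pt K i + b * ph K i) ^+ 2.
  by move=> hu; rewrite -(real_normK (num_real u)) -exprMn ler_sqr // nnegrE mulr_ge0 // ltW.
have := sq _ m1; have := sq _ m2.
have -> : px K i ^+ 2 + py K i ^+ 2 = (c * px K i + s * py K i) ^+ 2 + (c * py K i - s * px K i) ^+ 2.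
  rewrite -[LHS]mul1r -cs; ring.
clear; lra.
Qed.

(** The radius sqrt (1 - 1/9) of the circle of unit vectors at height -1/3. *)
Definition ring_radius (R : rcfType) : R := Num.sqrt 8 / 3.

Notation ring_missed K := (missed K (ring_radius _) (1/3)).

Lemma ring_radius_gt0 (R : rcfType) : 0 < ring_radius R.
Proof. by rewrite divr_gt0 // sqrtr_gt0. Qed.

Lemma ring_radiusE (R : rcfType) : ring_radius R ^+ 2 = 8 / 9.
Proof. by rewrite /ring_radius expr_div_n sqr_sqrtr //; field. Qed.

Lemma missed_ring (R : rcfType) (I : finType) (K : caps R I) (c s : R) i :
  c ^+ 2 + s ^+ 2 = 1 -> ring_missed K c s i ->
  0 <= 3 * pt K i + ph K i /\ 4 * (px K i ^+ 2 + py K i ^+ 2) <= (3 * pt K i + ph K i) ^+ 2.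
Proof.
move=> cs /(missed_sum (ring_radius_gt0 R) cs); rewrite ring_radiusE =>
  -[p0 p1]; split; first by clear - p0; lra.
have -> : 3 * pt K i + ph K i = 3 * (pt K i + 1 / 3 * ph K i) by field.
rewrite exprMn; clear - p1; lra.
Qed.

(** Two crosses confine the horizontal projection to an octagon instead of a square, which improves
    the constant 4 of [missed_ring] by the factor 1 + mu. *)
Lemma missed_twice (R : rcfType) (I : finType) (K : caps R I) (mu c s c' s' : R) i :
  c ^+ 2 + s ^+ 2 = 1 -> c' ^+ 2 + s' ^+ 2 = 1 ->
  0 < mu -> mu <= c * c' + s * s' -> mu <= `|c * s' - s * c'| -> ring_missed K c s i ->
    ring_missed K c' s' i ->
  4 * (1 + mu) * (px K i ^+ 2 + py K i ^+ 2) <= (3 * pt K i + ph K i) ^+ 2.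
Proof.
wlog S0 : c s c' s' / 0 <= c * s' - s * c'.
  move=> hw; have [S0|S0] := leP 0 (c * s' - s * c'); first exact: hw.
  move=> cs cs' mu0 muC muS m1 m2; apply: (hw c' s' c s) => //.
  - by rewrite subr_ge0 [c' * _]mulrC [s' * _]mulrC -subr_le0 ltW.
  - by rewrite [c' * _]mulrC [s' * _]mulrC.
  - by rewrite [c' * _]mulrC [s' * _]mulrC distrC.
move=> cs cs' mu0 muC muS /andP[m1 m2] /andP[m3 m4].
rewrite ger0_norm // in muS.
have [e1 e2] := @rotated_missedE R I K c s c' s' i cs.
rewrite e1 in m3; rewrite e2 in m4.
set p := pt K i + 1 / 3 * ph K i in m1 m2 m3 m4.
have H := @octagon _ mu (p / ring_radius R) (c * c' + s * s') (c * s' - s * c')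
  (c * px K i + s * py K i)
  (c * py K i - s * px K i) mu0 muC muS.
have : (1 + mu) * ((c * px K i + s * py K i) ^+ 2 + (c * py K i - s * px K i) ^+ 2)
  <= 2 * (p / ring_radius R) ^+ 2.
  have le u : ring_radius R * `|u| <= p -> `|u| <= p / ring_radius R
    by rewrite ler_pdivlMr ?ring_radius_gt0 // mulrC.
  apply: H; [|exact: le|exact: le|exact: le|exact: le].
  have -> : (c * c' + s * s') ^+ 2 + (c * s' - s * c') ^+ 2 = (c ^+ 2 + s ^+ 2) * (c' ^+ 2 + s' ^+ 2) by ring.
  by rewrite cs cs' mulr1.
have -> : (c * px K i + s * py K i) ^+ 2 + (c * py K i - s * px K i) ^+ 2 = px K i ^+ 2 + py K i ^+ 2.
  rewrite -[RHS]mul1r -cs; ring.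
rewrite expr_div_n ring_radiusE.
have -> : 3 * pt K i + ph K i = 3 * p by rewrite /p; field.
rewrite exprMn; clear; lra.
Qed.

Lemma tangent_top (R : rcfType) (I : finType) (K : caps R I) i : i != top K ->
  tangent_to (pt K (top K)) (pt K i) (ph K i).
Proof.
move=> io; have := disjoint_caps K io; rewrite px_top py_top !mulr0 !add0r /tangent_to.
have -> // : Num.sqrt (1 + pt K (top K) ^+ 2) = ph K (top K).
by rewrite -(vertexE K (top K)) px_top py_top expr0n /= !add0r sqrtr_sqr gtr0_norm // ph_top.
Qed.

Lemma planar_normE (R : rcfType) (I : finType) (K : caps R I) i :
  px K i ^+ 2 + py K i ^+ 2 = 1 + pt K i ^+ 2 - ph K i ^+ 2.
Proof. by rewrite -(vertexE K) addrK. Qed.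

(** By disjointness and Cauchy-Schwarz in the horizontal plane, t t' + h h' - 1 is at most the
    product of the lengths of the two projections, which the last two hypotheses bound. *)
Lemma separated (R : rcfType) (I : finType) (K : caps R I) (d a b : R) i j : i != j ->
  0 < d -> 0 <= a -> 0 <= b ->
  0 <= 3 * pt K i + ph K i -> 0 <= 3 * pt K j + ph K j -> d ^+ 2 <= a * b ->
  a * (px K i ^+ 2 + py K i ^+ 2) <= (3 * pt K i + ph K i) ^+ 2 ->
  b * (px K j ^+ 2 + py K j ^+ 2) <= (3 * pt K j + ph K j) ^+ 2 ->
  d * (pt K i * pt K j + ph K i * ph K j - 1) <= (3 * pt K i + ph K i) * (3 * pt K j + ph K j).
Proof.
move=> ij d0 a0 b0 pi pj dab hi hj.
have [le|lt] := leP (pt K i * pt K j + ph K i * ph K j - 1) 0.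
  by apply: (@le_trans _ _ 0); [rewrite pmulr_rle0|rewrite mulr_ge0].
set e := pt K i * pt K j + ph K i * ph K j - 1 in lt *.
rewrite -ler_sqr ?nnegrE ?mulr_ge0 // ?(ltW d0) ?(ltW lt) // !exprMn.
have e1 : e <= - (px K i * px K j + py K i * py K j)
  by have := disjoint_caps K ij; rewrite /e; clear; lra.
have e2 : e ^+ 2 <= (px K i ^+ 2 + py K i ^+ 2) * (px K j ^+ 2 + py K j ^+ 2).
  apply: (@le_trans _ _ ((px K i * px K j + py K i * py K j) ^+ 2)).
    by rewrite -(sqrrN (px K i * px K j + py K i * py K j)) ler_sqr ?nnegrE //;
      [exact: ltW|exact: le_trans (ltW lt) e1].
  have := sqr_ge0 (px K i * py K j - py K i * px K j); clear; lra.
apply: (@le_trans _ _ ((a * b) * e ^+ 2)); first by rewrite ler_wpM2r ?sqr_ge0.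
apply: (@le_trans _ _ ((a * b) * ((px K i ^+ 2 + py K i ^+ 2) * (px K j ^+ 2 + py K j ^+ 2)))).
  by rewrite ler_wpM2l // mulr_ge0.
by rewrite mulrACA ler_pM // mulr_ge0 // addr_ge0 ?sqr_ge0.
Qed.

Definition hitting (R : rcfType) (I : finType) (K : caps R I) (a b c s : R) (w : R * R * R) :=
  [/\ 0 < a /\ 0 < b, a ^+ 2 + b ^+ 2 = 1, c ^+ 2 + s ^+ 2 = 1,
  w.1.1 ^+ 2 + w.1.2 ^+ 2 + w.2 ^+ 2 = 1 & forall i, pole_hit K w i || ~~ missed K a b c s i].

Lemma pole_hit_top (R : rcfType) (I : finType) (K : caps R I) w : pole_hit K w (top K).
Proof.
apply/orP; left; rewrite -ltr_sqr ?nnegrE ?(ltW (ph_top K)) ?(ltW (pt_gt0 K (top K))) //.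
by have := vertexE K (top K); rewrite px_top py_top; clear; lra.
Qed.

Definition down (R : rcfType) : R * R * R := (0, 0, -1).

Lemma not_pole_hit_down (R : rcfType) (I : finType) (K : caps R I) i :
  ~~ pole_hit K (down R) i -> - pt K i <= ph K i /\ ph K i <= pt K i.
Proof.
rewrite /pole_hit /= negb_or -!leNgt => /andP[h1 h2].
by split; move: h1 h2; clear; lra.
Qed.

(** A ring at height -3/16 with any azimuth and w = - e_3 suffice: a missed cap contradicts
    [small_caps]. *)
Lemma hitting_small (R : rcfType) (I : finType) (K : caps R I) : pt K (top K) <= 17/20 ->
  exists a b c s w, hitting K a b c s w.
Proof.
move=> T1; pose a := Num.sqrt (1 - (3/16) ^+ 2 : R).
have a2 : a ^+ 2 = 1 - (3/16) ^+ 2 by rewrite sqr_sqrtr //; clear; lra.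
have a0 : 0 < a by rewrite sqrtr_gt0; clear; lra.
exists a, (3/16), 1, 0, (down R); split=> /=.
- by split=> //; rewrite divr_gt0.
- by rewrite a2; ring.
- by rewrite expr1n expr0n addr0.
- by rewrite expr0n /= !add0r sqrrN expr1n.
move=> i; apply: contraT; rewrite negb_or negbK => /andP[nh mi].
have io : i != top K by apply: contraNneq nh => ->; exact: pole_hit_top.
have [h1 h2] := not_pole_hit_down nh.
have [|p0 p1] := missed_sum a0 _ mi; first by rewrite expr1n expr0n addr0.
have := small_caps T1 (pt_gt0 K i) (pt_max K i) (tangent_top io) h1 h2.
rewrite a2 planar_normE in p1; move: p1; clear; lra.
Qed.

(** * Offending caps and the choice of the second vector *)

(* For d = 4 (1 + mu), this is implied by being missed at two azimuths whose difference has
   a cosine and a sine at least mu (missed_twice). *)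
Definition offending (R : rcfType) (I : finType) (K : caps R I) (d : R) (i : I) :=
  [&& i != top K, - pt K i <= ph K i, ph K i <= pt K i, 0 <= 3 * pt K i + ph K i &
      d * (px K i ^+ 2 + py K i ^+ 2) <= (3 * pt K i + ph K i) ^+ 2].

(* A necessary condition for being missed by the ring at some azimuth. *)
Definition ring_bad (R : rcfType) (I : finType) (K : caps R I) (i : I) :=
  [&& i != top K, 0 <= 3 * pt K i + ph K i &
      4 * (px K i ^+ 2 + py K i ^+ 2) <= (3 * pt K i + ph K i) ^+ 2].

Lemma ring_badE (R : rcfType) (I : finType) (K : caps R I) i : ring_bad K i ->
  4 <= 5 * pt K i ^+ 2 + 6 * pt K i * ph K i + 5 * ph K i ^+ 2.
Proof. by case/and3P=> _ _; rewrite planar_normE; clear; lra. Qed.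

Lemma offending_bad (R : rcfType) (I : finType) (K : caps R I) d i : 4 <= d ->
  offending K d i -> ring_bad K i.
Proof.
move=> d4 /and5P[io _ _ p0 hd]; apply/and3P; split=> //; apply: le_trans hd.
by rewrite ler_wpM2r // addr_ge0 ?sqr_ge0.
Qed.

(** Pointing w at the unique offending cap gives up - e_3, but the last hypothesis says that no
    other bad cap is then as low as - e_3 requires. Either way, bad caps left unhit satisfy |h| <= t
    and are not offending. *)
Lemma second_vector (R : rcfType) (I : finType) (K : caps R I) (d : R) : 4 <= d ->
  (forall i j, i != j -> offending K d i -> offending K d j -> False) ->
  (forall i j, i != j -> offending K d i -> ring_bad K j -> ph K j <= - pt K j -> False) ->
  exists w : R * R * R, w.1.1 ^+ 2 + w.1.2 ^+ 2 + w.2 ^+ 2 = 1 /\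
    exists2 m : option I, (if m is Some m then offending K d m : Prop else true) &
    forall i, ring_bad K i -> ~~ pole_hit K w i ->
    [/\ Some i != m, - pt K i <= ph K i, ph K i <= pt K i & ~~ offending K d i].
Proof.
move=> d4 Hoo Hol.
case: (pickP (offending K d)) => [m om|no]; last first.
  exists (down R); split; first by rewrite /= expr0n /= !add0r sqrrN expr1n.
  by exists None => // i _ /not_pole_hit_down[h1 h2]; rewrite no.
pose N := Num.sqrt (1 + pt K m ^+ 2).
have N0 : 0 < N by exact: sqrt1D_gt0.
have N2 : N ^+ 2 = 1 + pt K m ^+ 2 by exact: sqrt1DK.
exists (px K m / N, py K m / N, ph K m / N); split.
  rewrite /= !expr_div_n -!mulrDl vertexE N2 divff //.
  by rewrite -N2 gt_eqF // exprn_gt0.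
exists (Some m) => // i bi nh.
have im : i != m.
  apply: contraNneq nh => -> {i bi}; apply/orP; right => /=.
  have -> : px K m / N * px K m + py K m / N * py K m + ph K m / N * ph K m =
     (px K m ^+ 2 + py K m ^+ 2 + ph K m ^+ 2) / N by rewrite !expr2; field; rewrite gt_eqF.
  rewrite vertexE -N2 expr2 mulfK ?gt_eqF // -ltr_sqr ?nnegrE ?(ltW N0) ?(ltW (pt_gt0 K m)) //.
  by rewrite N2; clear; lra.
have hi : ph K i <= pt K i by move: nh; rewrite negb_or -!leNgt => /andP[].
split=> //.
  have [//|/ltW hlo] := leP (- pt K i) (ph K i).
  by case: (Hol m i); rewrite // eq_sym.
by apply/negP => oi; apply: (Hoo m i); rewrite // eq_sym.
Qed.

(** * Turning the ring *)

Definition turn (R : rcfType) (c s : R) (p : R * R) := (c * p.1 - s * p.2, s * p.1 + c * p.2).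

Lemma turn_unit (R : rcfType) (c s : R) p n : c ^+ 2 + s ^+ 2 = 1 -> p.1 ^+ 2 + p.2 ^+ 2 = 1 ->
  (iter n (turn c s) p).1 ^+ 2 + (iter n (turn c s) p).2 ^+ 2 = 1.
Proof.
move=> cs p1; elim: n => [//|n IH]; rewrite iterS /=.
set q := iter n _ _ in IH *.
transitivity ((c ^+ 2 + s ^+ 2) * (q.1 ^+ 2 + q.2 ^+ 2)); first by ring.
by rewrite IH cs mulr1.
Qed.

Lemma turn_relative (R : rcfType) (c s : R) p k d : c ^+ 2 + s ^+ 2 = 1 ->
  p.1 ^+ 2 + p.2 ^+ 2 = 1 ->
  let q := iter k (turn c s) p in let q' := iter (d + k) (turn c s) p in
  let r := iter d (turn c s) (1, 0) in
  q.1 * q'.1 + q.2 * q'.2 = r.1 /\ q.1 * q'.2 - q.2 * q'.1 = r.2.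
Proof.
move=> cs p1; rewrite iterD; have := turn_unit k cs p1.
set q := iter k _ p => q1 /=; elim: d => [|d [IH1 IH2]].
  by rewrite /= -!expr2 q1 mulrC subrr.
by rewrite !iterS /= -IH1 -IH2; split; ring.
Qed.

(** If all n azimuths fail, one unhit cap is chosen for each; these caps will be too many for the
    plane. *)
Lemma hitting_or_killers (R : rcfType) (I : finType) (K : caps R I) n (cr : 'I_n -> R * R) w :
  (forall k, (cr k).1 ^+ 2 + (cr k).2 ^+ 2 = 1) -> w.1.1 ^+ 2 + w.1.2 ^+ 2 + w.2 ^+ 2 = 1 ->
  (exists a b c s w, hitting K a b c s w) \/
  exists f : 'I_n -> I, forall k, [/\ ring_bad K (f k),
    ~~ pole_hit K w (f k) & ring_missed K (cr k).1 (cr k).2 (f k)].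
Proof.
move=> cr1 w1.
case: (boolP [exists k, [forall i, pole_hit K w i || ~~ ring_missed K (cr k).1 (cr k).2 i]])
  => [/existsP[k /forallP H]|].
  left; exists (ring_radius R), (1/3), (cr k).1, (cr k).2, w; split=> //.
    by rewrite ring_radius_gt0 divr_gt0.
  by rewrite ring_radiusE; field.
rewrite negb_exists => /forallP H; right.
have {}H k : exists i, ~~ pole_hit K w i && ring_missed K (cr k).1 (cr k).2 i.
  have := H k; rewrite negb_forall => /existsP[i]; rewrite negb_or negbK => hi; by exists i.
exists (fun k => xchoose (H k)) => k; have /andP[h1 h2] := xchooseP (H k); split=> //.
have [p0 p1] := missed_ring (cr1 k) h2.
apply/and3P; split=> //.
by apply: contraNneq h1 => ->; exact: pole_hit_top.
Qed.

Lemma offendingE (R : rcfType) (I : finType) (K : caps R I) d i : offending K d i ->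
  [/\ i != top K, - pt K i <= ph K i, ph K i <= pt K i, 0 <= 3 * pt K i + ph K i &
      d * (1 + pt K i ^+ 2 - ph K i ^+ 2) <= (3 * pt K i + ph K i) ^+ 2].
Proof. by case/and5P; rewrite planar_normE. Qed.

(* The argument of 260/269 + 69/269 i is slightly less than 15 degrees. *)
Lemma turn15 (R : rcfType) d : (0 < d < 6)%N ->
  let r := iter d (turn (260/269 : R) (69/269)) (1, 0) in 1/4 <= r.1 /\ 1/4 <= r.2.
Proof.
case: d => [|[|[|[|[|[|//]]]]]] //= _; rewrite /turn /=; split; lra.
Qed.

(** A cap chosen for two azimuths would be offending by [missed_twice]. *)
Lemma killers_inj (R : rcfType) (I : finType) (K : caps R I) n (c s mu : R) p (f : 'I_n -> I) :
  c ^+ 2 + s ^+ 2 = 1 -> p.1 ^+ 2 + p.2 ^+ 2 = 1 -> 0 < mu ->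
  (forall d, (0 < d < n)%N ->
     let r := iter d (turn c s) (1, 0) in mu <= r.1 /\ mu <= r.2) ->
  (forall k : 'I_n, let q := iter k (turn c s) p in ring_missed K q.1 q.2 (f k)) ->
  (forall k, [/\ ring_bad K (f k), - pt K (f k) <= ph K (f k), ph K (f k) <= pt K (f k)
                 & ~~ offending K (4 * (1 + mu)) (f k)]) -> injective f.
Proof.
move=> cs p1 mu0 Hr Hm Hf k l fkl; apply/eqP; apply: contraT => kl.
wlog lt : k l fkl kl / (k < l)%N.
  move=> hw; case: (ltngtP k l) => [|lk|e]; first exact: hw.
    by apply: (hw l k) => //; rewrite eq_sym.
  by rewrite -(inj_eq val_inj) /= e eqxx in kl.
have ld : (l - k + k = l)%N by rewrite subnK // ltnW.
have dn : (0 < l - k < n)%N by rewrite subn_gt0 lt (leq_ltn_trans (leq_subr _ _)).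
have [r1 r2] := Hr _ dn.
have [e1 e2] := turn_relative k (l - k) cs p1; rewrite ld in e1 e2.
have [bk h1 h2 /negP[]] := Hf k.
have /and3P[kt p0 _] := bk.
apply/and5P; split=> //.
apply: (missed_twice (turn_unit k cs p1) (turn_unit l cs p1) mu0 _ _ (Hm k)).
- by rewrite e1.
- by rewrite e2; apply: le_trans r2 (ler_norm _).
by rewrite fkl; exact: Hm.
Qed.

(** Any two of the six azimuths differ by an angle with cosine and sine at least 1/4, so mu = 1/4
    and d = 4 (1 + mu) = 5. Six distinct missed caps contradict [six_planar]. *)
Lemma hitting_mid (R : rcfType) (I : finType) (K : caps R I) :
  17/20 <= pt K (top K) -> (forall i, i != top K -> pt K i <= 13/10) ->
  exists a b c s w, hitting K a b c s w.
Proof.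
move=> T1 t13.
have off i : offending K 5 i -> ph K i <= -1.
  case/offendingE => io h1 h2 _ h3.
  apply: (mid_offending T1 (pt_gt0 K i) (pt_max K i) (t13 i io) (tangent_top io) h1 h2).
  by move: h3; clear; lra.
have [|i j ij oi oj|i j ij oi bj hj|w [w1 [m _ Hw]]] := @second_vector _ _ K 5.
- by clear; lra.
- have [io h1 h2 h3 h4] := offendingE oi; have [jo g1 g2 g3 g4] := offendingE oj.
  have := @mid_offending_pair _ _ _ _ _ (off _ oi) (off _ oj) h1 g1 (t13 _ io) (t13 _ jo).
  rewrite ltNge => /negP; apply.
  by apply: (@separated _ _ _ 5 5 5) => //; rewrite ?planar_normE //; clear; lra.
- have [io h1 h2 h3 h4] := offendingE oi; have /and3P[jo g3 g4] := bj.
  have := @mid_offending_low _ (pt K i) (- ph K i) _ _ _ _ (t13 _ io) (ltW (pt_gt0 K j)) hj (ring_badE bj).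
  rewrite mulNr !opprK ltNge => H.
  have /negP := H ltac:(have := off _ oi; clear; lra) ltac:(clear - h1; lra).
  apply; apply: (@separated _ _ _ (76/17) 5 4) => //; rewrite ?planar_normE //; clear; lra.
pose cr (k : 'I_6) := iter k (turn (260/269 : R) (69/269)) (1, 0).
have rho1 : (260/269 : R) ^+ 2 + (69/269) ^+ 2 = 1 by clear; lra.
have one1 : ((1, 0) : R * R).1 ^+ 2 + ((1, 0) : R * R).2 ^+ 2 = 1
  by rewrite /= expr1n expr0n addr0.
have cr1 k : (cr k).1 ^+ 2 + (cr k).2 ^+ 2 = 1 by exact: turn_unit.
have [//|[f Hf]] := hitting_or_killers K cr1 w1; exfalso.
have Hk k : [/\ ring_bad K (f k), - pt K (f k) <= ph K (f k), ph K (f k) <= pt K (f k)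
                 & ~~ offending K (4 * (1 + 1/4)) (f k)].
  have [bk nh _] := Hf k; have [_ h1 h2 h3] := Hw _ bk nh; split=> //.
  by have -> : 4 * (1 + 1 / 4) = 5 :> R by field.
have finj : injective f.
  apply: (killers_inj rho1 one1 _ _ _ Hk).
  - by rewrite divr_gt0.
  - by move=> d hd; exact: turn15.
  - by move=> k; have [] := Hf k.
pose q k := Num.sqrt (px K (f k) ^+ 2 + py K (f k) ^+ 2).
have q2 k : q k ^+ 2 = px K (f k) ^+ 2 + py K (f k) ^+ 2
  by rewrite sqr_sqrtr // addr_ge0 ?sqr_ge0.
apply: (@six_planar _ (fun k => px K (f k)) (fun k => py K (f k)) q) => //.
  by move=> k; rewrite sqrtr_ge0.
move=> k l kl; have fkl : f k != f l by rewrite (inj_eq finj).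
have [bk h1 h2 _] := Hk k; have [bl g1 g2 _] := Hk l.
have /and3P[ko _ _] := bk; have /and3P[lo _ _] := bl.
have := mid_bad_pair T1 (pt_gt0 K _) (pt_max K _) (t13 _ ko) (tangent_top ko) h1 h2 (sqrtr_ge0 _)
  (etrans (q2 k) (planar_normE K _)) (ring_badE bk)
  (pt_gt0 K _) (pt_max K _) (t13 _ lo) (tangent_top lo) g1 g2 (sqrtr_ge0 _)
  (etrans (q2 l) (planar_normE K _)) (ring_badE bl).
have := disjoint_caps K fkl; rewrite -/(q k) -/(q l); clear; lra.
Qed.

(** * The case of a large polar cap *)

Section Turn30.
Variable R : rcfType.
Let r3 : R := Num.sqrt 3 / 2.

Lemma r3E : r3 ^+ 2 = 3/4.
Proof. by rewrite expr_div_n sqr_sqrtr //; field. Qed.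

Lemma r3_ge : 1/2 <= r3.
Proof. by rewrite -ler_sqr ?nnegrE ?divr_ge0 ?sqrtr_ge0 // r3E; clear; lra. Qed.

Lemma turn30_unit : r3 ^+ 2 + (1/2) ^+ 2 = 1.
Proof. by rewrite r3E; field. Qed.

Lemma turn30 d : (0 < d < 3)%N ->
  let r := iter d (turn r3 (1/2)) (1, 0) in 1/2 <= r.1 /\ 1/2 <= r.2.
Proof.
have h := r3_ge; have e := r3E; rewrite expr2 in e.
by case: d => [|[|[|//]]] //= _; rewrite /turn /=; split; lra.
Qed.

End Turn30.

(** Three azimuths 30 degrees apart give mu = 1/2 and d = 6. Three missed caps and a fourth bad cap
    contradict [four_planar]; the fourth is the offending cap if there is one. *)
Lemma hitting_big (R : rcfType) (I : finType) (K : caps R I) :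
  13/10 <= pt K (top K) -> exists a b c s w, hitting K a b c s w.
Proof.
move=> T1.
have bad i : ring_bad K i -> - pt K i <= ph K i -> ph K i <= pt K i ->
    493/500 <= pt K i /\ ph K i <= - (17/100).
  move=> bi h1 h2; have /and3P[io _ _] := bi.
  exact: big_bad T1 (pt_gt0 K i) (tangent_top io) h1 h2 (ring_badE bi).
have obtuse i j : i != j -> ring_bad K i -> - pt K i <= ph K i -> ph K i <= pt K i ->
    ring_bad K j -> - pt K j <= ph K j -> ph K j <= pt K j ->
    px K i * px K j + py K i * py K j < 0.
  move=> ij bi h1 h2 bj g1 g2.
  have [i1 i2] := bad _ bi h1 h2; have [j1 j2] := bad _ bj g1 g2.
  have : (493/500) * (493/500) <= pt K i * pt K j.
    by apply: ler_pM; [clear; lra|clear; lra|exact: i1|exact: j1].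
  have : (17/100) * (17/100) <= - ph K i * - ph K j.
    by apply: ler_pM; [clear; lra|clear; lra|clear - i2; lra|clear - j2; lra].
  have := disjoint_caps K ij; clear; lra.
have off i : offending K 6 i -> ph K i <= -1 /\ pt K i <= - (9/5 * ph K i).
  move=> oi; have bi : ring_bad K i by apply: offending_bad oi; clear; lra.
  have [io h1 h2 _ h3] := offendingE oi.
  apply: (big_offending T1 (pt_gt0 K i) (pt_max K i) (tangent_top io) h1 h2 (ring_badE bi)).
  by move: h3; clear; lra.
have [|i j ij oi oj|i j ij oi bj hj|w [w1 [m om Hw]]] := @second_vector _ _ K 6.
- by clear; lra.
- have [io h1 h2 h3 h4] := offendingE oi; have [jo g1 g2 g3 g4] := offendingE oj.
  have [i1 i2] := off _ oi; have [j1 j2] := off _ oj.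
  have := big_offending_pair i1 j1 h1 g1 i2 j2.
  rewrite ltNge => /negP; apply.
  by apply: (@separated _ _ _ 6 6 6) => //; rewrite ?planar_normE //; clear; lra.
- have [io h1 h2 h3 h4] := offendingE oi; have /and3P[jo g3 g4] := bj.
  have [i1 i2] := off _ oi.
  have := @big_offending_low _ (pt K i) (- ph K i) _ _ _ _ _ (ltW (pt_gt0 K j)) hj (ring_badE bj).
  rewrite mulNr !opprK ltNge mulrN => H.
  have /negP := H ltac:(clear - i1; lra) ltac:(clear - h1; lra) i2.
  apply; apply: (@separated _ _ _ (93/19) 6 4) => //; rewrite ?planar_normE //; clear; lra.
pose r3 : R := Num.sqrt 3 / 2.
have one1 : ((1, 0) : R * R).1 ^+ 2 + ((1, 0) : R * R).2 ^+ 2 = 1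
  by rewrite /= expr1n expr0n addr0.
have mu6 : 4 * (1 + 1 / 2) = 6 :> R by field.
(* e is a fourth bad cap, which is hit, by w or the ring, at all three azimuths. *)
have conclude p e : p.1 ^+ 2 + p.2 ^+ 2 = 1 ->
    ring_bad K e -> - pt K e <= ph K e -> ph K e <= pt K e ->
    (forall (k : 'I_3) i, ring_bad K i -> ~~ pole_hit K w i ->
      let q := iter k (turn r3 (1/2)) p in ring_missed K q.1 q.2 i -> i != e) ->
    exists a b c s w, hitting K a b c s w.
  move=> p1 be he1 he2 He.
  pose cr (k : 'I_3) := iter k (turn r3 (1/2)) p.
  have cr1 k : (cr k).1 ^+ 2 + (cr k).2 ^+ 2 = 1 by apply: turn_unit => //; exact: turn30_unit.
  have [//|[f Hf]] := hitting_or_killers K cr1 w1; exfalso.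
  have Hk k : [/\ ring_bad K (f k), - pt K (f k) <= ph K (f k), ph K (f k) <= pt K (f k)
                 & ~~ offending K (4 * (1 + 1/2)) (f k)].
    by have [bk nh _] := Hf k; have [_ h1 h2 h3] := Hw _ bk nh; split=> //; rewrite mu6.
  have finj : injective f.
    apply: (killers_inj (turn30_unit R) p1 _ _ _ Hk).
    - by rewrite divr_gt0.
    - by move=> d hd; exact: turn30.
    - by move=> k; have [] := Hf k.
  have fe k : f k != e by have [bk nh mk] := Hf k; apply: He mk.
  pose g (k : 'I_4) := if unlift ord0 k is Some l then f l else e.
  apply: (@four_planar _ (fun k => px K (g k)) (fun k => py K (g k))) => k l kl.
  have gb k' : [/\ ring_bad K (g k'), - pt K (g k') <= ph K (g k') & ph K (g k') <= pt K (g k')].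
    by rewrite /g; case: unliftP => [l' _|_] //; have [] := Hk l'.
  have [b1 b2 b3] := gb k; have [b4 b5 b6] := gb l.
  apply: obtuse => //; apply: contraNneq kl; rewrite /g.
  case: unliftP => [k' ->|->]; case: unliftP => [l' ->|->] // E.
  - by rewrite (finj _ _ E).
  - by move: (fe k'); rewrite E eqxx.
  - by move: (fe l'); rewrite -E eqxx.
case: m om Hw => [m om|_] Hw.
  have [_ h1 h2 _ _] := offendingE om.
  apply: (conclude (1, 0) m) => //; first by apply: offending_bad om; clear; lra.
  move=> k i bi nh /= _; apply/eqP => im.
  by have [] := Hw i bi nh; rewrite im eqxx.
(* Without an offending cap, an arbitrary azimuth either works or misses a cap [b], which serves as
   the fourth. *)
have [//|[f Hf]] := @hitting_or_killers _ _ K 1 (fun=> (1, 0)) w (fun=> one1) w1.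
have [] := Hf ord0; set b := f ord0 => bb nh _.
have [_ h1 h2 nob] := Hw b bb nh.
pose q := Num.sqrt (px K b ^+ 2 + py K b ^+ 2).
have q2 : q ^+ 2 = px K b ^+ 2 + py K b ^+ 2 by rewrite sqr_sqrtr // addr_ge0 ?sqr_ge0.
have q0 : 0 < q.
  rewrite lt_neqAle sqrtr_ge0 andbT eq_sym -sqrf_eq0 q2 planar_normE gt_eqF //.
  have : 0 <= (pt K b + ph K b) * (pt K b - ph K b) by apply: mulr_ge0; clear - h1 h2; lra.
  clear; lra.
pose X := px K b / q; pose Y := py K b / q.
have XY : X ^+ 2 + Y ^+ 2 = 1.
  by rewrite /X /Y !expr_div_n -mulrDl -q2 divff // sqrf_eq0 gt_eqF.
have r30 : r3 ^+ 2 = 3/4 by exact: r3E.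
(* If a ring vector with azimuth within 30 degrees of [b] missed it, then 6 q^2 <= (3 t + h)^2 and
   [b] would be offending. *)
have aligned c s u : u ^+ 2 * 4 >= 3 -> c * X + s * Y = u -> ring_missed K c s b -> False.
  move=> u2 cE /andP[mb _].
  have cq : c * px K b + s * py K b = q * u by rewrite -cE /X /Y; field; rewrite gt_eqF.
  have /and3P[bo p0 _] := bb.
  move/negP: nob; apply; apply/and5P; split=> //.
  rewrite -q2.
  have : (ring_radius R * `|q * u|) ^+ 2 <= (pt K b + 1 / 3 * ph K b) ^+ 2.
    rewrite -cq ler_sqr // nnegrE; first by rewrite mulr_ge0 // ltW // ring_radius_gt0.
    by clear - p0; lra.
  rewrite exprMn real_normK ?num_real // ring_radiusE exprMn.
  have : 0 <= q ^+ 2 * (u ^+ 2 * 4 - 3) by rewrite mulr_ge0 ?sqr_ge0 ?subr_ge0.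
  clear; lra.
(* The azimuths are -30, 0 and 30 degrees from that of [b]. *)
apply: (conclude (turn r3 (- (1/2)) (X, Y)) b) => //.
  rewrite /turn /=; transitivity ((r3 ^+ 2 + 1/4) * (X ^+ 2 + Y ^+ 2)); first by field.
  by rewrite XY r30; field.
move=> k i _ _ /=; apply: contraTneq => ->; apply/negP.
case: k => -[|[|[|//]]] /= _; rewrite /turn /=.
- apply: (aligned _ _ r3); first by rewrite r30; clear; lra.
  transitivity (r3 * (X ^+ 2 + Y ^+ 2)); first by field.
  by rewrite XY mulr1.
- apply: (aligned _ _ 1); first by rewrite expr1n; clear; lra.
  transitivity ((r3 ^+ 2 + 1/4) * (X ^+ 2 + Y ^+ 2)); first by field.
  by rewrite XY r30; field.
- apply: (aligned _ _ r3); first by rewrite r30; clear; lra.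
  transitivity (r3 * ((r3 ^+ 2 + 1/4) * (X ^+ 2 + Y ^+ 2))); first by field.
  by rewrite XY r30; field.
Qed.

Lemma hitting_exists (R : rcfType) (I : finType) (K : caps R I) :
  exists a b c s w, hitting K a b c s w.
Proof.
have [T1|/ltW T1] := leP (pt K (top K)) (17/20); first exact: hitting_small.
have [T2|/ltW T2] := leP (pt K (top K)) (13/10); last exact: hitting_big.
by apply: hitting_mid => // i _; apply: le_trans (pt_max K i) T2.
Qed.

(** * Inner product and reflections *)

Definition dot (R : pzRingType) n (a b : 'rV[R]_n) : R := \sum_(i < n) a 0 i * b 0 i.

Section Dot.
Variables (R : realFieldType) (n : nat).
Implicit Types (a b : 'rV[R]_n) (k : R).

Lemma dotC a b : dot a b = dot b a.
Proof. by apply: eq_bigr => i _; rewrite mulrC. Qed.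

Lemma dotDr a b c : dot a (b + c) = dot a b + dot a c.
Proof. by rewrite -big_split; apply: eq_bigr => i _; rewrite mxE mulrDr. Qed.

Lemma dotZr k a b : dot a (k *: b) = k * dot a b.
Proof. by rewrite /dot mulr_sumr; apply: eq_bigr => i _; rewrite mxE mulrCA. Qed.

Lemma dotDl a b c : dot (b + c) a = dot b a + dot c a.
Proof. by rewrite dotC dotDr !(dotC a). Qed.

Lemma dotZl k a b : dot (k *: b) a = k * dot b a.
Proof. by rewrite dotC dotZr dotC. Qed.

Lemma dotNr a b : dot a (- b) = - dot a b.
Proof. by rewrite -scaleN1r dotZr mulN1r. Qed.

Lemma dotNl a b : dot (- b) a = - dot b a.
Proof. by rewrite dotC dotNr dotC. Qed.

Lemma dot_ge0 a : 0 <= dot a a.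
Proof. by apply: sumr_ge0 => i _; rewrite -expr2 sqr_ge0. Qed.

Lemma dot_eq0 a : (dot a a == 0) = (a == 0).
Proof.
apply/eqP/eqP => [/eqP|->]; last by rewrite -(scale0r 0) dotZr mul0r.
rewrite psumr_eq0 => [/allP h|i _]; last by rewrite -expr2 sqr_ge0.
apply/rowP => i; have := h i (mem_index_enum i); rewrite -expr2 sqrf_eq0 mxE.
by move/eqP.
Qed.

(** The reflection in the hyperplane orthogonal to a - b. It will carry the vertex of a largest cap
    to the vertical axis. *)
Lemma householder a b : dot a a = dot b b ->
  exists f : 'rV[R]_n -> 'rV[R]_n,
    [/\ forall c d, dot (f c) (f d) = dot c d, forall c, f (f c) = c & f a = b].
Proof.
move=> ab; have [->|nab] := eqVneq a b; first by exists id.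
have [v vE] : {v | v = a - b} by exists (a - b).
have v0 : dot v v != 0 by rewrite dot_eq0 vE subr_eq0.
exists (fun c => c - (2 * dot v c / dot v v) *: v); split.
- move=> c d; rewrite !(dotDl, dotDr, dotNr, dotNl, dotZr, dotZl) (dotC c v).
  by field.
- move=> c; rewrite !(dotDr, dotNr, dotZr) -addrA -!(scaleNr _ v) -scalerDl -[RHS]addr0.
  congr (_ + _); have -> : forall r, r = 0 -> r *: v = 0 by move=> r ->; rewrite scale0r.
    by [].
  by field.
have vvE : dot v v = 2 * dot v a.
  by rewrite vE !(dotDl, dotDr, dotNr, dotNl) -ab (dotC b a); ring.
by rewrite -vvE divff // scale1r vE subKr.
Qed.

End Dot.

(** * The six vectors in coordinates *)

Definition vec3 (R : pzRingType) (p : R * R * R) : 'rV[R]_3 :=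
  \row_(i < 3) [:: p.1.1; p.1.2; p.2]`_i.

Lemma dot3E (R : pzRingType) (a b : 'rV[R]_3) :
  dot a b = a 0 0 * b 0 0 + a 0 1 * b 0 1 + a 0 (2%:R) * b 0 (2%:R).
Proof.
rewrite /dot !big_ord_recl big_ord0 addr0 addrA.
by congr (_ + _ + _); congr (_ * _); congr (_ _ _); apply: val_inj.
Qed.

Lemma dot_vec3 (R : pzRingType) p (b : 'rV[R]_3) :
  dot (vec3 p) b = p.1.1 * b 0 0 + p.1.2 * b 0 1 + p.2 * b 0 (2%:R).
Proof. by rewrite dot3E !mxE. Qed.

Definition frame (R : rcfType) (a b c s : R) (w : R * R * R) : seq (R * R * R) :=
  [:: (0, 0, 1); w; (a * c, a * s, - b); (- (a * s), a * c, - b);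
      (- (a * c), - (a * s), - b); (a * s, - (a * c), - b)].

Lemma frame_unit (R : rcfType) (a b c s : R) w (k : 'I_6) :
  a ^+ 2 + b ^+ 2 = 1 -> c ^+ 2 + s ^+ 2 = 1 -> w.1.1 ^+ 2 + w.1.2 ^+ 2 + w.2 ^+ 2 = 1 ->
  dot (vec3 (nth (0, 0, 0) (frame a b c s w) k)) (vec3 (nth (0, 0, 0) (frame a b c s w) k)) = 1.
Proof.
move=> ab cs w1.
have e : a ^+ 2 * (c ^+ 2 + s ^+ 2) + b ^+ 2 = 1 by rewrite cs mulr1.
case: k => -[|[|[|[|[|[|//]]]]]] /= _; rewrite dot_vec3 !mxE /=.
- by rewrite !mul0r !add0r mulr1.
- by rewrite -!expr2.
all: by rewrite -[RHS]e; ring.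
Qed.

Lemma cross_hits (R : realFieldType) (a c s x y e : R) : 0 < a ->
  ~~ ((a * `|c * x + s * y| <= e) && (a * `|c * y - s * x| <= e)) ->
  [\/ e < a * (c * x + s * y), e < - (a * (c * x + s * y)),
      e < a * (c * y - s * x) | e < - (a * (c * y - s * x))].
Proof.
move=> a0; rewrite negb_and -!ltNge -{1 2}(gtr0_norm a0) -!normrM !ltr_normr.
by case/orP => /orP[]; [exact: Or41|exact: Or42|exact: Or43|exact: Or44].
Qed.

(** The threshold [e] is the tangent t for a vertex, and 0 in [frame_spans]. *)
Lemma frame_hits (R : rcfType) (a b c s e : R) w (y : 'rV[R]_3) : 0 < a ->
  [|| e < y 0 (2%:R), e < w.1.1 * y 0 0 + w.1.2 * y 0 1 + w.2 * y 0 (2%:R) |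
    ~~ ((a * `|c * y 0 0 + s * y 0 1| <= e + b * y 0 (2%:R)) &&
        (a * `|c * y 0 1 - s * y 0 0| <= e + b * y 0 (2%:R)))] ->
  exists k : 'I_6, e < dot (vec3 (nth (0, 0, 0) (frame a b c s w) k)) y.
Proof.
move=> a0 /or3P[h|h|/(cross_hits a0)].
- by exists (inord 0); rewrite dot_vec3 inordK //= !mul0r !add0r mul1r.
- by exists (inord 1); rewrite dot_vec3 inordK.
case=> h; [exists (inord 2)|exists (inord 4)|exists (inord 3)|exists (inord 5)];
  by rewrite dot_vec3 inordK //=; lra.
Qed.

(** If neither e_3 nor the ring has a positive product with y, both cross coordinates and the height
    of y vanish. *)
Lemma frame_spans (R : rcfType) (a b c s : R) w (y : 'rV[R]_3) : 0 < a -> 0 < b ->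
  c ^+ 2 + s ^+ 2 = 1 -> y != 0 ->
  exists k : 'I_6, 0 < dot (vec3 (nth (0, 0, 0) (frame a b c s w) k)) y.
Proof.
move=> a0 b0 cs y0; apply: frame_hits => //.
rewrite add0r; have [//|y2] := ltP 0 (y 0 (2%:R)); rewrite /=; apply/orP; right.
apply: contra y0 => /andP[h1 h2].
have by2 : b * y 0 (2%:R) <= 0 by rewrite pmulr_rle0.
have zero (u : R) : a * `|u| <= b * y 0 (2%:R) -> u = 0 /\ y 0 (2%:R) = 0.
  move=> hu; have : 0 <= a * `|u| by rewrite mulr_ge0 // ltW.
  move=> hu0; have e0 : b * y 0 (2%:R) = 0 by apply/eqP; rewrite eq_le by2 (le_trans hu0).
  split; last by move/eqP: e0; rewrite mulf_eq0 gt_eqF //= => /eqP.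
  have : a * `|u| == 0 by rewrite eq_le hu0 -e0 hu.
  by rewrite mulf_eq0 normr_eq0 (gt_eqF a0) => /eqP.
have [z1 z2] := zero _ h1; have [z3 _] := zero _ h2.
have y00 : y 0 0 = 0.
  by rewrite -[LHS]mul1r -cs; transitivity (c * (c * y 0 0 + s * y 0 1) - s * (c * y 0 1 - s * y 0 0));
    [ring|rewrite z1 z3 !mulr0 subrr].
have y01 : y 0 1 = 0.
  by rewrite -[LHS]mul1r -cs; transitivity (s * (c * y 0 0 + s * y 0 1) + c * (c * y 0 1 - s * y 0 0));
    [ring|rewrite z1 z3 !mulr0 addr0].
by rewrite -dot_eq0 dot3E y00 y01 z2 !mul0r !addr0.
Qed.

(** The vertices are reflected so that a largest cap becomes polar; the six vectors found there are
    reflected back. *)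
Lemma six_vectors (R : rcfType) (I : finType) (o0 : I) (v : I -> 'rV[R]_3) :
  (forall i, 1 < dot (v i) (v i)) ->
  (forall i j, i != j ->
    dot (v i) (v j) <= 1 - Num.sqrt (dot (v i) (v i) - 1) * Num.sqrt (dot (v j) (v j) - 1)) ->
  exists W : 'I_6 -> 'rV[R]_3, [/\ forall k, dot (W k) (W k) = 1,
    forall y, y != 0 -> exists k, 0 < dot (W k) y &
    forall i, exists k, Num.sqrt (dot (v i) (v i) - 1) < dot (W k) (v i)].
Proof.
move=> v1 sep; pose t i := Num.sqrt (dot (v i) (v i) - 1).
have t0 i : 0 < t i by rewrite sqrtr_gt0 subr_gt0.
have tE i : t i ^+ 2 = dot (v i) (v i) - 1 by rewrite sqr_sqrtr // subr_ge0 ltW.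
have [o _ omax] : exists2 o, true & forall i, t i <= t o.
  by case: (@arg_maxP _ _ I o0 xpredT t isT) => o _ h; exists o => // i; exact: h.
pose r := Num.sqrt (dot (v o) (v o)).
have [|f [fdot ff fo]] := @householder _ _ (v o) (vec3 (0, 0, r)).
  by rewrite [RHS]dot_vec3 !mxE /= !mul0r !add0r -expr2 sqr_sqrtr // dot_ge0.
pose x i := f (v i) 0 0; pose y i := f (v i) 0 1; pose h i := f (v i) 0 (2%:R).
have xyh i j : x i * x j + y i * y j + h i * h j = dot (v i) (v j) by rewrite -fdot dot3E.
have h1 i : x i ^+ 2 + y i ^+ 2 + h i ^+ 2 = 1 + t i ^+ 2
  by rewrite tE !expr2 xyh addrCA subrr addr0.
have h2 i j : i != j -> x i * x j + y i * y j + h i * h j <= 1 - t i * t j.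
  by move=> ij; rewrite xyh; exact: sep.
have h3 : x o = 0 by rewrite /x fo mxE.
have h4 : y o = 0 by rewrite /y fo mxE.
have h5 : 0 < h o by rewrite /h fo mxE /= sqrtr_gt0; apply: lt_trans (v1 o).
pose K := @Caps R I x y h t o t0 h1 h2 h3 h4 h5 omax.
have [a [b [c [s [w [[a0 b0] ab cs w1 H]]]]]] := hitting_exists K.
have fW W z : dot (f W) z = dot W (f z) by rewrite -[in LHS](ff z) fdot.
exists (fun k => f (vec3 (nth (0, 0, 0) (frame a b c s w) k))); split.
- by move=> k; rewrite fdot frame_unit.
- move=> z z0; have fz0 : f z != 0 by rewrite -dot_eq0 fdot dot_eq0.
  by have [k hk] := frame_spans w a0 b0 cs fz0; exists k; rewrite fW.
move=> i; have [|k hk] := @frame_hits R a b c s (t i) w (f (v i)) a0.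
  by have := H i; rewrite /pole_hit -orbA.
by exists k; rewrite fW.
Qed.

(** * The Euclidean ball and convex sets *)

Section Ball.
Variables (R : realType) (n : nat).
Implicit Types (a b c : 'rV[R]_n) (l : R).

Lemma dot_sqr a : dot a a = \sum_(i < n) a 0 i ^+ 2.
Proof. by apply: eq_bigr => i _; rewrite expr2. Qed.

Lemma in_ball a : euclid_unit_ball a <-> dot a a <= 1.
Proof.
rewrite /euclid_unit_ball /euclid_norm /= -dot_sqr.
by rewrite -{1}(sqrtr1 R) ler_sqrt.
Qed.

Lemma dot_continuous : continuous (fun a : 'rV[R]_n => dot a a).
Proof.
have -> : (fun a : 'rV[R]_n => dot a a) = \sum_(i < n) (fun a : 'rV[R]_n => a 0 i * a 0 i).
  by apply/funext => a; rewrite fct_sumE.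
move=> a.
elim/big_ind: _ => [|f g cf cg|i _].
- exact: cst_continuous.
- by apply: continuousD.
by apply: continuousM; exact: coord_continuous.
Qed.

Lemma convex_set_comb (A : set 'rV[R]_n) : convex_set A <->
  forall a b l, A a -> A b -> 0 <= l -> l <= 1 -> A (l *: a + (1 - l) *: b).
Proof.
split=> [cA a b l Aa Ab l0 l1|cA a b l /set_mem Aa /set_mem Ab].
  have := cA a b (Itv01 l0 l1) (mem_set Aa) (mem_set Ab).
  by move/set_mem.
apply/mem_set; apply: cA => //.
Qed.

End Ball.

(** * The cap body as a union of spikes *)

Section Hull.
Variables (R : realType) (n : nat).
Implicit Types (a b c : 'rV[R]_n) (l : R).

Notation B := (@euclid_unit_ball R n).

(** The homothety of ratio l centred at b (a translation when l = 1 and b = 0 is trivial) is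
    replaced by its inverse form [f], which is continuous and sends the point to c; nearby points
    therefore come from the ball. *)
Lemma interior_comb (K : set 'rV[R]_n) b c l : convex_set K -> B `<=` K -> K b ->
  0 < l -> l <= 1 -> dot c c < 1 -> interior K (l *: c + (1 - l) *: b).
Proof.
move=> cK BK Kb l0 l1 c1.
pose f (y : 'rV[R]_n) : 'rV[R]_n := l^-1 *: (y - (1 - l) *: b).
set p : 'rV[R]_n := l *: c + _.
have fK y : l *: f y + (1 - l) *: b = y.
  by rewrite /f scalerA divff ?gt_eqF // scale1r subrK.
have fp : f p = c by rewrite /f /p addrK scalerA mulVf ?gt_eqF // scale1r.
have cf : f y @[y --> p] --> f p.
  have c1' : (fun y : 'rV[R]_n => y - (1 - l) *: b) @ p --> p - (1 - l) *: b.
    exact: (cvgB cvg_id (cvg_cst _)).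
  exact: (cvgZ (cvg_cst _) c1').
have near_p : \forall y \near p, dot (f y) (f y) < 1.
  have : nbhs (dot (f p) (f p)) [set r : R | r < 1].
    by apply: open_nbhs_nbhs; split; [exact: open_lt|rewrite /= fp].
  have h := cvg_comp _ _ cf (@dot_continuous R n (f p)).
  by move=> H; exact: (h _ H).
rewrite /interior /=; apply: filterS near_p => y y1.
rewrite -(fK y); have [_ H] := (convex_set_comb K); have [cK' _] := (convex_set_comb K).
apply: cK' => //; last exact: ltW.
by apply: BK; apply/in_ball/ltW.
Qed.

(** Convexity of the ball in homogeneous form, so that zero total weight needs no exception
    later. *)
Lemma ball_comb b1 b2 l1 l2 : B b1 -> B b2 -> 0 <= l1 -> 0 <= l2 ->
  exists2 d, B d & l1 *: b1 + l2 *: b2 = (l1 + l2) *: d.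
Proof.
move=> B1 B2 l10 l20; have [e|ne] := eqVneq (l1 + l2) 0.
  have /andP[/eqP -> /eqP ->] : (l1 == 0) && (l2 == 0) by rewrite -paddr_eq0 // e.
  by exists b1 => //; rewrite !addr0 !scale0r addr0.
exists ((l1 + l2)^-1 *: (l1 *: b1 + l2 *: b2)); last by rewrite scalerA divff // scale1r.
have l0 : 0 < l1 + l2 by rewrite lt_neqAle eq_sym ne addr_ge0.
move/in_ball: B1 => B1; move/in_ball: B2 => B2; apply/in_ball.
rewrite dotZr dotZl mulrA -invfM -expr2 mulrC ler_pdivrMr ?exprn_gt0 // mul1r.
have d12 : dot b1 b2 <= 1.
  have := dot_ge0 (b1 - b2); rewrite !(dotDl, dotDr, dotNl, dotNr) (dotC b2 b1); lra.
rewrite !(dotDl, dotDr, dotZl, dotZr) (dotC b2 b1).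
have : l1 * l2 * dot b1 b2 <= l1 * l2 * 1 by rewrite ler_wpM2l // mulr_ge0.
have : l1 ^+ 2 * dot b1 b1 <= l1 ^+ 2 * 1 by rewrite ler_wpM2l // sqr_ge0.
have : l2 ^+ 2 * dot b2 b2 <= l2 ^+ 2 * 1 by rewrite ler_wpM2l // sqr_ge0.
clear; lra.
Qed.

Variables (I : finType) (x : I -> 'rV[R]_n) (o : I).
Hypothesis x_out : forall i, ~ B (x i).
Hypothesis x_seg : forall i j, i != j -> segment (x i) (x j) `&` B !=set0.

Lemma segment_param i j : i != j ->
  exists s, [/\ 0 < s, s < 1 & B ((1 - s) *: x i + s *: x j)].
Proof.
move=> ij; have [_ [[s /andP[s0 s1] <-] Bs]] := x_seg ij; exists s; split=> //.
- rewrite lt_neqAle s0 andbT; apply/eqP => s_0; apply: (@x_out i).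
  by move: Bs; rewrite -s_0 subr0 scale1r scale0r addr0.
- rewrite lt_neqAle s1 andbT; apply/eqP => s_1; apply: (@x_out j).
  by move: Bs; rewrite s_1 subrr scale1r scale0r add0r.
Qed.

(** The inequality on the weights says that the point lies on the b side of the ball point of the
    segment, hence between that point and b. *)
Lemma spike_comb a b s l1 l2 : 0 < s -> s < 1 -> B ((1 - s) *: a + s *: b) ->
  0 <= l1 -> 0 <= l2 -> l1 * s <= l2 * (1 - s) ->
  exists d r, [/\ B d, 0 <= r, r <= l1 + l2 &
    l1 *: a + l2 *: b = (l1 + l2 - r) *: d + r *: b].
Proof.
move=> s0 s1 Bs l10 l20 le; have s10 : 0 < 1 - s by lra.
exists ((1 - s) *: a + s *: b), (l2 - l1 * s / (1 - s)); split=> //.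
- by rewrite subr_ge0 ler_pdivrMr.
- have : 0 <= l1 * s / (1 - s) by rewrite divr_ge0 ?mulr_ge0 // ltW.
  lra.
have -> : l1 + l2 - (l2 - l1 * s / (1 - s)) = l1 / (1 - s) by field; rewrite gt_eqF.
rewrite scalerDr !scalerA -addrA -scalerDl; congr (_ *: _ + _ *: _).
  by rewrite divfK // gt_eqF.
by rewrite mulrAC subrKC.
Qed.

Lemma segment_comb i j l1 l2 : 0 <= l1 -> 0 <= l2 ->
  exists d k r, [/\ B d, 0 <= r, r <= l1 + l2 &
    l1 *: x i + l2 *: x j = (l1 + l2 - r) *: d + r *: x k].
Proof.
move=> l10 l20; have [<-|ij] := eqVneq i j.
  exists 0, i, (l1 + l2); split=> //; last by rewrite subrr scale0r add0r scalerDl.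
    by apply/in_ball; rewrite -(scale0r 0) dotZr mul0r.
  by rewrite addr_ge0.
have [s [s0 s1 Bs]] := segment_param ij.
have [le|/ltW le] := leP (l1 * s) (l2 * (1 - s)).
  by have [d [r [? ? ? ?]]] := spike_comb s0 s1 Bs l10 l20 le; exists d, j, r.
have [||||||d [r [? ? ? E]]] := @spike_comb (x j) (x i) (1 - s) l2 l1.
- by lra.
- by lra.
- by rewrite subKr addrC.
- by [].
- by [].
- by rewrite subKr.
by exists d, i, r; split=> //; rewrite 1?addrC // (addrC l1) -E addrC.
Qed.

(** The convex hull of the ball and x_i, written as a continuous image of a compact set, which makes
    it closed. *)
Definition spike i := [set (1 - p.2) *: p.1 + p.2 *: x i | p in B `*` `[0, 1]].

Lemma ball_compact : compact B.
Proof.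
apply: bounded_closed_compact.
  exists 1; split=> // M M1 v /in_ball v1 /=; apply: le_trans (ltW M1).
  rewrite [leLHS]/Num.Def.normr /= mx_normrE; apply: bigmax_le => // -[u k] _ /=.
  rewrite ord1 -ler_sqr ?nnegrE // real_normK ?num_real // expr1n.
  apply: le_trans v1; rewrite dot_sqr (bigD1 k) //= lerDl.
  by apply: sumr_ge0 => ? _; exact: sqr_ge0.
have -> : B = (fun a => dot a a) @^-1` [set r | r <= 1].
  by apply/seteqP; split => a /in_ball.
have /continuous_closedP h := @dot_continuous R n.
by apply: h; exact: closed_le.
Qed.

Lemma spike_closed i : closed (spike i).
Proof.
apply: compact_closed; first exact: norm_hausdorff.
apply: continuous_compact; last
  by apply: compact_setX; [exact: ball_compact|exact: segment_compact].
apply: continuous_subspaceT => p.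
have c2 : (fun q : 'rV[R]_n * R => q.2) @ p --> p.2 by exact: cvg_snd.
have c1 : (fun q : 'rV[R]_n * R => q.1) @ p --> p.1 by exact: cvg_fst.
have c3 : (fun q : 'rV[R]_n * R => 1 - q.2) @ p --> 1 - p.2 by exact: (cvgB (cvg_cst _) c2).
exact: (cvgD (cvgZ c3 c1) (cvgZ c2 (cvg_cst (x i)))).
Qed.

(** It suffices that the finite union of spikes is closed and convex. *)
Lemma hull_spike : closed_convex_hull (B `|` range x) `<=` \bigcup_i spike i.
Proof.
apply: smallest_sub; last first.
  move=> z [Bz|[i _ <-]].
    exists o => //; exists (z, 0); first by split=> //=; rewrite in_itv /= lexx ler01.
    by rewrite /= subr0 scale1r scale0r addr0.
  exists i => //; exists (0, 1) => /=; last by rewrite subrr scale0r scale1r add0r.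
  split; last by rewrite /= in_itv /= ler01 lexx.
  by apply/in_ball; rewrite -(scale0r 0) dotZr mul0r.
split; first by apply: closed_bigcup => [|i _]; [exact: finite_finset|exact: spike_closed].
apply/convex_set_comb => u v l [i _ [[b1 a1] [/= B1]]].
rewrite in_itv /= => /andP[a10 a11] <- [j _ [[b2 a2] [/= B2]]].
rewrite in_itv /= => /andP[a20 a21] <- l0 l1 {u v}.
have l10 : 0 <= 1 - l by lra.
have a110 : 0 <= 1 - a1 by lra.
have a210 : 0 <= 1 - a2 by lra.
(* The ball parts are merged, the two vertex parts are reduced to one vertex and a ball part, and
   the ball parts are merged again. *)
have [d1 D1 E1] := ball_comb B1 B2 (mulr_ge0 l0 a110) (mulr_ge0 l10 a210).
have [d2 [k [r [D2 r0 rle E2]]]] := segment_comb i j (mulr_ge0 l0 a10) (mulr_ge0 l10 a20).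
have w0 : 0 <= l * (1 - a1) + (1 - l) * (1 - a2) by rewrite addr_ge0 // mulr_ge0.
have w1 : 0 <= l * a1 + (1 - l) * a2 - r by rewrite subr_ge0.
have [d3 D3 E3] := ball_comb D1 D2 w0 w1.
exists k => //; exists (d3, r).
  split=> //=; rewrite in_itv /= r0 /=; apply: le_trans rle _.
  have : 0 <= l * (1 - a1) by exact: mulr_ge0.
  have : 0 <= (1 - l) * (1 - a2) by exact: mulr_ge0.
  by lra.
rewrite /= !scalerDr !scalerA addrACA E1 E2 addrA E3; congr (_ *: _ + _).
by ring.
Qed.

(** Expand the squared norm, at most 1, of the ball point of the segment and use that ((1 - s) t - s
    u)^2 >= 0. *)
Lemma dot_sep i j : i != j ->
  dot (x i) (x j) <= 1 - Num.sqrt (dot (x i) (x i) - 1) * Num.sqrt (dot (x j) (x j) - 1).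
Proof.
have x1 k : 1 < dot (x k) (x k).
  by rewrite ltNge; apply/negP => /in_ball; exact: x_out.
move=> ij; have [s [s0 s1 /in_ball]] := segment_param ij.
set t := Num.sqrt _; set u := Num.sqrt _.
have tE : dot (x i) (x i) = 1 + t ^+ 2 by rewrite sqr_sqrtr ?subr_ge0 ?ltW // addrC subrK.
have uE : dot (x j) (x j) = 1 + u ^+ 2 by rewrite sqr_sqrtr ?subr_ge0 ?ltW // addrC subrK.
rewrite !(dotDl, dotDr, dotZl, dotZr) (dotC (x j) (x i)) tE uE => h.
have sp : 0 < s * (1 - s) by rewrite mulr_gt0 // subr_gt0.
rewrite -subr_ge0 -(pmulr_rge0 _ sp).
have := sqr_ge0 ((1 - s) * t - s * u).
by move: h; lra.
Qed.

End Hull.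

(** * Illumination by the six opposite vectors *)

(** Only an inclusion of [K] in the hull is assumed, so that the ball itself is covered, with an
    auxiliary vertex. *)
Lemma illuminated_spikes (R : realType) (I : finType) (x : I -> 'rV[R]_3) (o : I)
    (K : set 'rV[R]_3) :
  (forall i, ~ euclid_unit_ball (x i)) ->
  (forall i j, i != j -> segment (x i) (x j) `&` @euclid_unit_ball R 3 !=set0) ->
  convex_set K -> @euclid_unit_ball R 3 `<=` K ->
  K `<=` closed_convex_hull (@euclid_unit_ball R 3 `|` range x) ->
  exists v : 'I_6 -> 'rV[R]_3, illuminated_by K v.
Proof.
move=> x_out x_seg cK BK KS.
have x1 i : 1 < dot (x i) (x i).
  by rewrite ltNge; apply/negP => /in_ball; exact: x_out.
have [W [W1 Wspan Whit]] := six_vectors o x1 (dot_sep x_out x_seg).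
exists (fun k => - W k); split=> [k|z [clz _]].
  by rewrite /direction /euclid_norm -dot_sqr dotNl dotNr opprK W1 sqrtr1.
have : closure (\bigcup_i spike x i) z.
  by apply: closureS clz => y /KS; exact: hull_spike.
have : closed (\bigcup_i spike x i).
  by apply: closed_bigcup => [|i _]; [exact: finite_finset|exact: spike_closed].
move=> /closure_id <- [i _ [[b l] [/= Bb]]].
rewrite in_itv /= => /andP[l0 l1] <- {z clz}.
have [l_0|l_n0] := eqVneq l 0.
  rewrite l_0 subr0 scale1r scale0r addr0.
  have [b0|bn0] := eqVneq b 0.
    exists ord0, 0; split; first by exists 0 => //=; rewrite b0 scale0r addr0.
    have -> : (0 : 'rV[R]_3) = 1 *: 0 + (1 - 1) *: 0 by rewrite subrr !scale0r scaler0 addr0.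
    apply: interior_comb => //; first
      by apply: BK; apply/in_ball; rewrite -(scale0r 0) dotZr mul0r.
    by rewrite -(scale0r 0) dotZr mul0r.
  (* Removing the component along W leaves squared norm |b|^2 - <W, b>^2 < 1. *)
  have [k hk] := Wspan b bn0; exists k, (b - dot (W k) b *: W k); split.
    by exists (dot (W k) b); rewrite /= ?ltW // scalerN.
  set c := b - _; have -> : c = 1 *: c + (1 - 1) *: 0 by rewrite subrr scale1r scale0r addr0.
  apply: interior_comb => //; first by apply: BK; apply/in_ball; rewrite -(scale0r 0) dotZr mul0r.
  rewrite /c !(dotDl, dotDr, dotNl, dotNr, dotZl, dotZr) W1 (dotC b (W k)).
  move/in_ball: Bb; have : 0 < dot (W k) b ^+ 2 by rewrite exprn_gt0.
  by clear; lra.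
have [k hk] := Whit i; set g := dot (W k) (x i) in hk.
have g0 : 0 < g by apply: le_lt_trans hk; exact: sqrtr_ge0.
(* Moving by l g along - W replaces x_i in the combination by x_i - g W, which is in the open ball
   as g > t_i. *)
exists k, (l *: (x i - g *: W k) + (1 - l) *: b); split.
  exists (l * g) => /=; first by rewrite mulr_ge0 // ltW.
  by rewrite /= scalerN scalerBr scalerA -[LHS]addrA [LHS]addrC.
apply: interior_comb => //; first exact: BK.
  by rewrite lt_neqAle eq_sym l_n0.
rewrite !(dotDl, dotDr, dotNl, dotNr, dotZl, dotZr) W1 (dotC (x i) (W k)) -/g.
have : dot (x i) (x i) - 1 < g ^+ 2.
  rewrite -[X in X < _]sqr_sqrtr ?subr_ge0 ?ltW //.
  by rewrite ltr_sqr // nnegrE ?sqrtr_ge0 // ltW.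
by clear; lra.
Qed.

Theorem theorem2 (R : realType) (K : set 'rV[R]_3) (hK : cap_body K) :
  (illumination_number K <= 6%:R%:E)%E.
Proof.
apply: ereal_inf_lbound; exists 6%N => //=.
case: hK => m [x [xinj x_out x_seg KE]].
have cK : convex_set K.
  apply/convex_set_comb => a b l Ka Kb l0 l1; rewrite KE => C [[clC cC] sC].
  have [H _] := convex_set_comb C; apply: (H cC) => //.
    by move: Ka; rewrite KE; exact.
  by move: Kb; rewrite KE; exact.
have BK : @euclid_unit_ball R 3 `<=` K.
  by move=> y By; rewrite KE => C [_ sC]; apply: sC; left.
case: m x xinj x_out x_seg KE => [|m] x xinj x_out x_seg KE.
  (* Without vertices K is the ball; any point outside the ball serves as the auxiliary vertex. *)
  pose e (_ : unit) : 'rV[R]_3 := vec3 (0, 0, 2).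
  apply: (@illuminated_spikes _ _ e tt) => //.
    by move=> i /in_ball; rewrite dot_vec3 !mxE /=; lra.
  move=> y; rewrite KE => Ky C [clC sC]; apply: Ky; split=> //.
  by move=> z [Bz|[[]//]]; apply: sC; left.
apply: (@illuminated_spikes _ _ x ord0) => //; last by rewrite -KE.
move=> i j ij; case: (ltngtP i j) => [lt|gt|e].
- exact: x_seg.
- have [y [[s /andP[s0 s1] <-] By]] := x_seg _ _ gt.
  exists ((1 - s) *: x j + s *: x i); split=> //.
  exists (1 - s); last by rewrite subKr addrC.
  by rewrite /= subr_ge0 s1 /= gerBl.
by move: ij; rewrite -val_eqE /= e eqxx.
Qed.
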